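(* Let $k>1$ and $c$ be odd integers, let $a,b>1$ be integers, and let $\Gamma$ be a finite Abelian group of order $abc$ with $\exp(\Gamma)\not\equiv 0 \pmod 8$. A $\Gamma$-magic rectangle set $\mathrm{MRS}_{\Gamma}(a,b;c)$ exists if and only if $a$ and $b$ are both even, or $\Gamma\in\mathcal{G}$ and $\{a,b\}\neq\{2k+1,2\}$.
   Context: All groups are finite Abelian, written additively. $\exp(\Gamma)$ is the least common multiple of the orders of all elements of $\Gamma$. An involution is an element of order $2$. $\mathcal{G}$ denotes the set of all Abelian groups that are of odd order or contain more than one involution. For a finite Abelian group $\Gamma$ of order $abc$, a $\Gamma$-magic rectangle set $\mathrm{MRS}_{\Gamma}(a,b;c)$ is a collection of $c$ arrays of size $a\times b$ whose entries are elements of $\Gamma$, each element of $\Gamma$ appearing exactly once in the whole collection, such that there are constants $\omega,\delta\in\Gamma$ for which every row sum in every array equals $\omega$ and every column sum in every array equals $\delta$. *)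

(* Defs.v *)
From HB Require Import structures.
From mathcomp Require Import all_boot all_order all_algebra all_fingroup all_solvable.

Set Implicit Arguments.
Unset Strict Implicit.
Unset Printing Implicit Defensive.

Import GRing.Theory.

Local Open Scope ring_scope.

(* [#[x]%g] and [exponent] refer to the additive group of [Gamma]: a
   [finZmodType] is canonically a [finGroupType] whose product is [+%R]
   (see [zmodMgE] in finalg). *)

Definition involution_set (Gamma : finZmodType) : {set Gamma} :=
  [set x : Gamma | #[x]%g == 2%N].

Definition in_calG (Gamma : finZmodType) : bool :=
  odd #|Gamma| || (1 < #|involution_set Gamma|)%N.

Definition is_MRS (Gamma : finZmodType) (a b c : nat)
    (M : 'I_c -> 'M[Gamma]_(a, b)) : Prop :=
  (forall x : Gamma,
     exists! p : 'I_c * ('I_a * 'I_b), M p.1 p.2.1 p.2.2 = x) /\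
  exists omega delta : Gamma,
    (forall (s : 'I_c) (i : 'I_a), \sum_(j < b) M s i j = omega) /\
    (forall (s : 'I_c) (j : 'I_b), \sum_(i < a) M s i j = delta).

(* Main.v *)
Require Import Defs.
From HB Require Import structures.
From mathcomp Require Import all_boot all_order all_algebra all_fingroup all_solvable.
From mathcomp Require Import zify ring.

(** Necessity.  If a and b are not both even and Gamma is not in the class G,
    then Gamma has exactly one involution i, and pairing x with - x shows that
    the sum of all elements is i.  Say b is odd.  Adding the rows gives
    i = (a c) omega, and b times this is |Gamma| omega = 0, whereas b i = i.
    If {a, b} = {2k+1, 2}, then |Gamma| is twice an odd number; but a group
    with two involutions contains a Klein four-group and its order is divisible
    by 4, so such a Gamma is not in G.

    Sufficiency rests on two reductions.  Stacking arrays of one family on top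
    of each other (or side by side) multiplies a (or b) and divides c, so it is
    enough to treat small a and b (magic_stack_ord).  And if H is a subgroup
    of odd index, arrays over H extend to arrays over Gamma (magic_extend):
    along a chain of subgroups of odd prime index r = 2m+1, a new generator g
    is added with integer coefficients in the window [-m, m].  These
    coefficients come from three permutations of the window with sum zero and
    their opposites, placed so that every row and every column cancels in the
    integers, hence without any carry into the smaller subgroup.

    - a and b even.  Let U be a subgroup of index 2, t an involution in U and g
      an element outside U.  The 2 x 2 blocks
        r       g - t - r
        g - r   r + t
      where r runs over representatives of U modulo t, partition Gamma.

    - a and b odd.  It is enough to fill one p x q array with a subgroup of
      order p q, for primes p | a and q | b.  If p = q, a pair of orthogonal
      Latin squares does it (magic_square_prime).  If p < q, rows and columns
      are multiplied by suitable weights (magic_rect_primes).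

    - a even, b odd, Gamma in G.  The Sylow 2-subgroup S contains a Klein
      four-group and has exponent at most 4.  It is enough to fill one
      |S| x q array with S + <u>, where u has prime order q | b.  Columns with
      large coefficients of u come in opposite pairs (magic_of_core); the
      middle columns, with coefficients 0, 1, -1, are made of three
      permutations of S with sum zero (core_of_split_triple).  Such
      permutations are found by induction: outside the small orders, S has a
      subgroup T with a Klein four-group and S/T a Klein four-group
      (exists_index4_has_klein), and a zero-sum triple extends from T to S
      (extend_triple).  This is where the exponent enters: Z_2 x Z_8 has no
      such T.  Order 8 is settled by a table.  A group S of order 4
      has no triple balanced in this way, and two other tables are used, with
      three middle columns for q = 3 and five for larger q. *)

Set Implicit Arguments.
Unset Strict Implicit.
Unset Printing Implicit Defensive.

Import GRing.Theory FinRing.Theory.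

Local Open Scope ring_scope.

(** * Adjoining one element to a subgroup of a finite abelian group *)

Section Subgroups.

Variable V : finZmodType.
Implicit Types (H K G : {group V}) (x y g : V).

Lemma memgD H x y : x \in H -> y \in H -> x + y \in H.
Proof. by move=> Hx Hy; rewrite -zmodMgE groupM. Qed.

Lemma memgN H x : (- x \in H) = (x \in H).
Proof. by rewrite -zmodVgE groupV. Qed.

Lemma memg0 H : 0 \in H.
Proof. by rewrite -zmod1gE group1. Qed.

Lemma memgB H x y : x \in H -> y \in H -> x - y \in H.
Proof. by move=> Hx Hy; rewrite memgD ?memgN. Qed.

Lemma memgDl H x y : x \in H -> (x + y \in H) = (y \in H).
Proof. by move=> Hx; rewrite -zmodMgE groupMl. Qed.

Lemma memgMn H x n : x \in H -> x *+ n \in H.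
Proof. by move=> Hx; rewrite -zmodXgE groupX. Qed.

Lemma memgMz H x (n : int) : x \in H -> x *~ n \in H.
Proof.
by move=> Hx; case: n => n; rewrite ?NegzE ?mulrNz ?memgN -pmulrn memgMn.
Qed.

Lemma memg_sum H (I : finType) (P : pred I) (F : I -> V) :
  (forall i, P i -> F i \in H) -> \sum_(i | P i) F i \in H.
Proof.
move=> HF; elim/big_ind: _ => //; [exact: memg0|exact: memgD].
Qed.

Lemma mulrn_card_group H x : x \in H -> x *+ #|H| = 0.
Proof.
by move=> Hx; rewrite -zmodXgE -zmod1gE; apply/eqP; rewrite -order_dvdn order_dvdG.
Qed.

(** The class of g in the quotient by H has order r; the coefficients are
    integers because centred windows of coefficients are used below. *)
Definition order_modulo H g (r : nat) : Prop :=
  forall n : int, (g *~ n \in H) = (r %| n)%Z.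

Lemma order_modulo_prime H g r :
  prime r -> g \notin H -> g *+ r \in H -> order_modulo H g r.
Proof.
move=> pr gH grH n; apply/idP/idP; last first.
  by case/dvdzP=> m ->; rewrite mulrC mulrzA -pmulrn memgMz.
move=> gn; apply/negPn/negP => rn; move/negP: gH; apply.
have cop: coprimez r n.
  rewrite coprimezE /= prime_coprime //.
case/coprimezP: cop => -[u v] /= uv.
rewrite -[g]mulr1z -uv mulrzDr [u * _]mulrC [v * _]mulrC !mulrzA.
by rewrite memgD // memgMz // -pmulrn.
Qed.

Lemma dvdz_small (r : nat) (n : int) : (r %| n)%Z -> `|n| < r%:Z -> n = 0.
Proof.
move=> rn nr; apply/eqP; rewrite -absz_eq0 -leqn0 leqNgt; apply/negP => n0.
by have := dvdn_leq n0 rn; lia.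
Qed.

Lemma order_modulo_eq H g r h h' (m n : int) :
  order_modulo H g r -> h \in H -> h' \in H -> h + g *~ m = h' + g *~ n ->
  (r %| m - n)%Z.
Proof.
move=> gr Hh Hh' E; rewrite -gr mulrzBr.
have -> : g *~ m - g *~ n = h' - h.
  by apply/eqP; rewrite subr_eq addrAC -E addrAC subrr add0r.
exact: memgB.
Qed.

(** Coefficients of g lying in a window shorter than its order modulo H are
    determined by the sum, as is the part in H.  All bijectivity proofs below
    reduce to this. *)
Lemma order_modulo_inj H g r h h' (m n : int) :
  order_modulo H g r -> h \in H -> h' \in H -> h + g *~ m = h' + g *~ n ->
  `|m - n| < r%:Z -> h = h' /\ m = n.
Proof.
move=> gr Hh Hh' E mn.
have mn0 : m = n.
  by apply/eqP; rewrite -subr_eq0 (dvdz_small (order_modulo_eq gr Hh Hh' E)).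
by split=> //; move: E; rewrite mn0 => /addIr.
Qed.

Lemma adjoin_subgroup H g r : (0 < r)%N -> order_modulo H g r ->
  exists K, [/\ H \subset K, g \in K, #|K| = (#|H| * r)%N &
    forall x, x \in K -> exists2 h, h \in H & exists n : nat, x = h + g *+ n].
Proof.
move=> r0 gr.
(* The multiples n g with n < r represent the cosets of H in the group. *)
pose A : {set V} := [set p.1 + g *+ (p.2 : 'I_r) | p in setX H [set: 'I_r]].
have inA h n : h \in H -> h + g *+ n \in A.
  move=> Hh; apply/imsetP.
  exists (h + g *+ (n %/ r * r), Ordinal (ltn_pmod n r0)).
    rewrite !inE andbT /= memgD // pmulrn gr.
    by apply/dvdzP; exists (n %/ r)%:Z; rewrite PoszM.
  by rewrite /= -addrA -mulrnDr -divn_eq.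
have gA : group_set A.
  apply/group_setP; split.
    by rewrite zmod1gE -[0](addr0 0) -(mulr0n g) inA // memg0.
  move=> x y /imsetP[[h m] /=]; rewrite !inE /= andbT => Hh ->.
  move=> /imsetP[[k n] /=]; rewrite !inE /= andbT => Hk ->.
  by rewrite zmodMgE addrACA -mulrnDr inA // memgD.
exists (group gA); split => /=.
- by apply/subsetP => x Hx; rewrite -[x]addr0 -(mulr0n g) inA.
- by rewrite -[g]add0r -[g in _ + g]mulr1n inA // memg0.
- rewrite card_in_imset ?cardsX ?cardsT ?card_ord //.
  move=> [h m] [k n]; rewrite !inE !andbT /= => Hh Hk.
  rewrite !pmulrn => E.
  have [|-> mn] := order_modulo_inj gr Hh Hk E.
    by have := ltn_ord m; have := ltn_ord n; lia.
  by congr pair; apply: val_inj => /=; case: mn.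
move=> x /imsetP[[h n] /=]; rewrite !inE andbT /= => Hh ->.
by exists h => //; exists n.
Qed.

(** Cauchy's theorem in the quotient G / H. *)
Lemma exists_order_modulo_prime H G r :
  H \subset G -> prime r -> (r %| #|G : H|%g)%N ->
  exists2 g, g \in G & g \notin H /\ g *+ r \in H.
Proof.
move=> HG pr rGH.
have nHG : G \subset 'N(H)%g.
  by rewrite normal_norm // -sub_abelian_normal ?zmod_abelian.
have := rGH; rewrite -card_quotient // => /(Cauchy pr)[X].
case/morphimP => g Ng Gg ->{X} /= og.
exists g => //; split.
  apply: contraTN pr => Hg.
  by move: og; rewrite coset_id // order1 => <-.
rewrite -zmodXgE; apply: coset_idr; first by rewrite groupX.
by rewrite morphX // -og expg_order.
Qed.

(** Induction on d, adjoining one element of prime order modulo H each time. *)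
Lemma exists_intermediate_group H G d :
  H \subset G -> (d %| #|G : H|%g)%N ->
  exists K, [/\ H \subset K, K \subset G & #|K| = (#|H| * d)%N].
Proof.
elim/ltn_ind: d H => d IH H HG dGH.
have d0 : (0 < d)%N by apply: dvdn_gt0 dGH; rewrite indexg_gt0.
have [d1|d1] := leqP d 1.
  have d_1 : d = 1%N by lia.
  by exists H; split=> //; rewrite d_1 muln1.
have pr := pdiv_prime d1; set r := pdiv d in pr.
have rd : (r %| d)%N by apply: pdiv_dvd.
have [g Gg [gH grH]] := exists_order_modulo_prime HG pr (dvdn_trans rd dGH).
have [K [HK gK cK memK]] :=
  adjoin_subgroup (prime_gt0 pr) (order_modulo_prime pr gH grH).
have KG : K \subset G.
  apply/subsetP => x /memK[h Hh [n ->]].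
  by rewrite memgD ?memgMn // (subsetP HG).
have iK : (#|G : H|%g = #|G : K|%g * r)%N.
  apply/eqP; rewrite -(eqn_pmul2l (cardG_gt0 H)) Lagrange //.
  by rewrite mulnCA -cK mulnC Lagrange.
have [||L [KL LG cL]] := IH (d %/ r)%N _ K KG.
- by rewrite ltn_Pdiv ?prime_gt1.
- by rewrite -(dvdn_pmul2r (prime_gt0 pr)) divnK // -iK.
exists L; split=> //; first exact: subset_trans KL.
by rewrite cL cK -mulnA [(r * _)%N]mulnC divnK.
Qed.

End Subgroups.

(** * Families of arrays over a subset of a group, and reductions *)

Lemma card_eq_bij (S T : finType) : #|S| = #|T| -> exists f : S -> T, bijective f.
Proof.
move=> E; exists (fun x => enum_val (cast_ord E (enum_rank x))).
exists (fun y => enum_val (cast_ord (esym E) (enum_rank y))) => x.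
  by rewrite enum_valK cast_ordK enum_rankK.
by rewrite enum_valK cast_ordKV enum_rankK.
Qed.

Section MagicFamilies.

Variable V : finZmodType.
Implicit Types (A : {set V}) (H K G : {group V}) (S T I J : finType).

(** Arrays are indexed by arbitrary finite types, so that stacking, transposing
    and extending are mere changes of the index types; A is the set that the
    entries enumerate. *)
Definition magic A S I J : Prop :=
  exists M : S -> I -> J -> V, [/\
    forall s i j s' i' j', M s i j = M s' i' j' -> [/\ s = s', i = i' & j = j'],
    forall s i j, M s i j \in A,
    #|A| = (#|S| * (#|I| * #|J|))%N &
    exists omega delta, (forall s i, \sum_j M s i j = omega) /\
                        (forall s j, \sum_i M s i j = delta)].

Lemma magic_reindex A S I J S' I' J' :
  #|S'| = #|S| -> #|I'| = #|I| -> #|J'| = #|J| -> magic A S I J -> magic A S' I' J'.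
Proof.
move=> eS eI eJ [M [Minj MA cA [w [d [row col]]]]].
have [f bf] := card_eq_bij eS; have [g bg] := card_eq_bij eI.
have [h bh] := card_eq_bij eJ.
exists (fun s i j => M (f s) (g i) (h j)); split=> //.
- move=> s i j s' i' j' /Minj[/(bij_inj bf)-> /(bij_inj bg)-> /(bij_inj bh)->].
  by [].
- by rewrite eS eI eJ.
exists w, d; split=> [s i|s j].
  by rewrite -(row (f s) (g i)) [RHS](reindex h) //; apply: onW_bij.
by rewrite -(col (f s) (h j)) [RHS](reindex g) //; apply: onW_bij.
Qed.

Lemma magic_transpose A S I J : magic A S I J -> magic A S J I.
Proof.
move=> [M [Minj MA cA [w [d [row col]]]]].
exists (fun s j i => M s i j); split=> //.
- by move=> s j i s' j' i' /Minj[].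
- by rewrite cA [(#|I| * _)%N]mulnC.
by exists d, w.
Qed.

(** Stacking the arrays indexed by T multiplies the column sums by |T| and
    leaves the rows alone. *)
Lemma magic_stack A S T I J : magic A (S * T)%type I J -> magic A S (T * I)%type J.
Proof.
move=> [M [Minj MA cA [w [d [row col]]]]].
exists (fun s p j => M (s, p.1) p.2 j); split=> //.
- by move=> s [t i] j s' [t' i'] j' /Minj /= [[-> ->] -> ->].
- by rewrite cA !card_prod !mulnA.
exists w, (d *+ #|T|); split=> [s [t i]|s j]; first exact: row.
rewrite -(pair_bigA _ (fun t i => M (s, t) i j)) /=.
by rewrite (eq_bigr (fun=> d)) ?sumr_const.
Qed.

Lemma magic_stack_ord A S m n m' n' c :
  (0 < m')%N -> (0 < n')%N -> (m %| m')%N -> (n %| n')%N ->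
  #|A| = (c * (m' * n'))%N ->
  magic A S 'I_m 'I_n -> magic A 'I_c 'I_m' 'I_n'.
Proof.
move=> m'0 n'0 /dvdnP[k km] /dvdnP[l ln] cA MA.
have m0 : (0 < m)%N by case: m km {MA} => [|//]; rewrite muln0 => km; rewrite km in m'0.
have n0 : (0 < n)%N by case: n ln {MA} => [|//]; rewrite muln0 => ln; rewrite ln in n'0.
have cS : #|S| = (c * l * k)%N.
  case: MA => _ [_ _ + _]; rewrite cA !card_ord km ln => E.
  apply/eqP; rewrite -(eqn_pmul2r (_ : 0 < m * n)%N) ?muln_gt0 ?m0 //.
  by rewrite -E; apply/eqP; ring.
have H1 : magic A ('I_c * 'I_l * 'I_k)%type 'I_m 'I_n.
  by apply: magic_reindex MA; rewrite ?card_prod ?card_ord.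
have H2 := magic_stack (magic_transpose (magic_stack H1)).
by apply: magic_reindex (magic_transpose H2);
  rewrite ?card_prod ?card_ord // ?km ?ln.
Qed.

Lemma magic_is_MRS a b c :
  magic [set: V] 'I_c 'I_a 'I_b ->
  exists M : 'I_c -> 'M[V]_(a, b), is_MRS M.
Proof.
move=> [M [Minj MA cA [w [d [row col]]]]].
exists (fun s => \matrix_(i, j) M s i j); split; last first.
  exists w, d; split=> [s i|s j].
    by rewrite -(row s i); apply: eq_bigr => j _; rewrite mxE.
  by rewrite -(col s j); apply: eq_bigr => i _; rewrite mxE.
pose F (p : 'I_c * ('I_a * 'I_b)) := M p.1 p.2.1 p.2.2.
have Finj : injective F.
  by move=> [s [i j]] [s' [i' j']] /Minj /= [-> -> ->].
have [G FK GK] : bijective F.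
  apply: inj_card_bij => //.
  by rewrite !card_prod -cardsT cA.
move=> x; exists (G x); split; first by rewrite mxE -/(F _) GK.
by move=> p; rewrite mxE -/(F _) => <-; rewrite FK.
Qed.

(** A row of length n is filled with values e_p f(p + z), e_p a sign and f a
    zero-sum function on Z/3.  Such a pattern serves rows and columns at once:
    the row index provides the shift z of the pattern along the columns, and
    conversely. *)
Definition zero_sum_pattern (L : seq ('I_3 * bool)) : Prop :=
  forall f : 'I_3 -> int, \sum_c f c = 0 ->
  forall z, \sum_(p <- L) (-1) ^+ p.2 * f (p.1 + z) = 0.

(** Either all three values of f, or none, and then pairs of opposite values. *)
Lemma exists_zero_sum_pattern n : (1 < n)%N ->
  exists2 L, size L = n & zero_sum_pattern L.
Proof.
elim/ltn_ind: n => n IH n1.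
have [n4|n3] := leqP 4 n.
  have [||L sL ZL] := IH (n - 2)%N; [lia|lia|].
  exists ((0, false) :: (0, true) :: L); first by rewrite /= sL; lia.
  move=> f f0 z; rewrite !big_cons ZL //= addr0 expr0 expr1 mul1r mulN1r subrr.
  by [].
have [->|n2] := eqVneq n 2.
  exists [:: (0, false); (0, true)] => // f f0 z.
  by rewrite !big_cons big_nil /= addr0 expr0 expr1 mul1r mulN1r subrr.
have -> : n = 3 by lia.
exists [seq (c, false) | c <- enum 'I_3]; first by rewrite size_map size_enum_ord.
move=> f f0 z; rewrite big_map big_enum /= -[RHS]f0.
rewrite [RHS](reindex_inj (addIr z)) /=.
by apply: eq_bigr => c _; rewrite expr0 mul1r.
Qed.

(** Three permutations of the window [-m, m] with sum zero: the first increases,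
    the second visits [-m, 0] at even k and [1, m] at odd k, so that minus their
    sum visits [0, m] at even k and [-m, -1] at odd k. *)
Definition kotzig m (c : 'I_3) (k : nat) : int :=
  match nat_of_ord c with
  | 0 => k%:Z - m%:Z
  | 1 => if odd k then m%:Z - k./2%:Z else - k./2%:Z
  | _ => if odd k then - (k./2.+1)%:Z else m%:Z - k./2%:Z
  end.

Lemma kotzig_sum m k : \sum_c kotzig m c k = 0.
Proof.
rewrite !big_ord_recl big_ord0 /kotzig /=.
by case: ifP => ok; have := odd_double_half k; rewrite ok; lia.
Qed.

Lemma kotzig_inj m c k l : (k < m.*2.+1)%N -> (l < m.*2.+1)%N ->
  kotzig m c k = kotzig m c l -> k = l.
Proof.
have := odd_double_half k; have := odd_double_half l.
rewrite /kotzig; case: c => [[|[|[|//]]] ?] /=; first lia.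
  by case: (odd k); case: (odd l); lia.
by case: (odd k); case: (odd l); lia.
Qed.

Lemma kotzig_bound m c k : (k < m.*2.+1)%N -> `|kotzig m c k| <= m%:Z.
Proof.
have := odd_double_half k.
rewrite /kotzig; case: c => [[|[|[|//]]] ?] /=; first lia.
  by case: (odd k); lia.
by case: (odd k); lia.
Qed.

(** Copy k of the array is shifted by plus or minus g times one of the three
    kotzig values at k.  For fixed (i, j) the coefficients run over the whole
    window [-m, m], and their row and column sums vanish in the integers. *)
Lemma magic_adjoin_odd H g m a b S :
  order_modulo H g m.*2.+1 -> (1 < a)%N -> (1 < b)%N ->
  magic H S 'I_a 'I_b ->
  exists K, [/\ H \subset K, g \in K, #|K| = (#|H| * m.*2.+1)%N,
    (forall x, x \in K -> exists2 h, h \in H & exists n : nat, x = h + g *+ n) &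
    magic K (S * 'I_(m.*2.+1))%type 'I_a 'I_b].
Proof.
move=> gm a1 b1 [M [Minj MA cA [w [d [row col]]]]].
have [K [HK gK cK memK]] := adjoin_subgroup (ltn0Sn _) gm.
exists K; split=> //.
have [La sa Za] := exists_zero_sum_pattern a1.
have [Lb sb Zb] := exists_zero_sum_pattern b1.
pose pa (i : 'I_a) := nth (0, false) La i.
pose pb (j : 'I_b) := nth (0, false) Lb j.
pose sg i j k : int :=
  (-1) ^+ (pa i).2 * ((-1) ^+ (pb j).2 * kotzig m ((pa i).1 + (pb j).1) k).
have sgE i j k : sg i j k = kotzig m ((pa i).1 + (pb j).1) k \/
                 sg i j k = - kotzig m ((pa i).1 + (pb j).1) k.
  rewrite /sg; case: (pa i).2; case: (pb j).2; rewrite ?expr0 ?expr1; lia.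
have sg_bound i j (k : 'I_(m.*2.+1)) : `|sg i j k| <= m%:Z.
  have := kotzig_bound ((pa i).1 + (pb j).1) (ltn_ord k).
  by case: (sgE i j k) => ->; lia.
have sg_inj i j (k l : 'I_(m.*2.+1)) : sg i j k = sg i j l -> k = l.
  move=> E; apply/val_inj/(kotzig_inj (ltn_ord k) (ltn_ord l) (c := (pa i).1 + (pb j).1)).
  move: E; rewrite /sg; set x := kotzig _ _ _; set y := kotzig _ _ _.
  by case: (pa i).2; case: (pb j).2; rewrite /= ?expr0 ?expr1; lia.
have sg_row i k : \sum_j sg i j k = 0.
  rewrite -mulr_sumr; suff -> : \sum_j (-1) ^+ (pb j).2 * kotzig m ((pa i).1 + (pb j).1) k
    = 0 by rewrite mulr0.
  rewrite -[RHS](Zb (kotzig m ^~ k) (kotzig_sum m k) (pa i).1).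
  rewrite (big_nth (0, false)) big_mkord sb.
  by apply: eq_bigr => j _; rewrite addrC.
have sg_col j k : \sum_i sg i j k = 0.
  transitivity ((-1) ^+ (pb j).2 *
    \sum_i (-1) ^+ (pa i).2 * kotzig m ((pa i).1 + (pb j).1) k).
    by rewrite mulr_sumr; apply: eq_bigr => i _; rewrite /sg mulrCA.
  suff -> : \sum_i (-1) ^+ (pa i).2 * kotzig m ((pa i).1 + (pb j).1) k = 0
    by rewrite mulr0.
  rewrite -[RHS](Za (kotzig m ^~ k) (kotzig_sum m k) (pb j).1).
  by rewrite (big_nth (0, false)) big_mkord sa.
exists (fun (s : S * 'I_(m.*2.+1)) i j => M s.1 i j + g *~ sg i j s.2); split.
- move=> [s k] i j [s' k'] i' j' /= E.
  have [|EM Esg] := order_modulo_inj gm (MA s i j) (MA s' i' j') E.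
    by have := sg_bound i j k; have := sg_bound i' j' k'; lia.
  have [es ei ej] := Minj _ _ _ _ _ _ EM; rewrite -es -ei -ej in Esg *.
  by rewrite (sg_inj _ _ _ _ Esg).
- by move=> s i j; rewrite memgD ?memgMz // (subsetP HK).
- by rewrite cK cA card_prod !card_ord; ring.
exists w, d; split=> [[s k] i|[s k] j] /=.
  by rewrite big_split /= row -mulrz_sumr sg_row mulr0z addr0.
by rewrite big_split /= col -mulrz_sumr sg_col mulr0z addr0.
Qed.

(** Induction on the index, by steps of odd prime index. *)
Lemma magic_extend H G a b S S' :
  H \subset G -> odd #|G : H|%g -> (1 < a)%N -> (1 < b)%N ->
  magic H S 'I_a 'I_b -> #|S'| = (#|S| * #|G : H|%g)%N -> magic G S' 'I_a 'I_b.
Proof.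
move=> HG oGH a1 b1.
move: {2}#|G : H|%g (leqnn #|G : H|%g) => n.
elim: n H S HG oGH => [|n IH] H S HG oGH.
  by rewrite leqn0 eqn0Ngt indexg_gt0.
move=> len MH cS'.
have [GH|GH] := leqP #|G : H|%g 1.
  have iGH : #|G : H|%g = 1%N by apply/eqP; rewrite eqn_leq GH indexg_gt0.
  have -> : G = H.
    by apply/val_inj/eqP; rewrite /= eqEsubset HG andbT -indexg_eq1 iGH.
  by apply: magic_reindex MH; rewrite ?card_ord // cS' iGH muln1.
have pr := pdiv_prime GH; set r := pdiv _ in pr.
have rd : (r %| #|G : H|%g)%N by apply: pdiv_dvd.
have [g Gg [gH grH]] := exists_order_modulo_prime HG pr rd.
have or : odd r by apply: dvdn_odd oGH.
pose m := r./2; have rm : r = m.*2.+1 by have := odd_double_half r; rewrite or /m; lia.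
have := order_modulo_prime pr gH grH; rewrite rm => gm.
have [K [HK gK cK memK MK]] := magic_adjoin_odd gm a1 b1 MH.
have KG : K \subset G.
  apply/subsetP => x /memK[h Hh [l ->]].
  by rewrite memgD ?memgMn // (subsetP HG).
have iK : (#|G : H|%g = #|G : K|%g * r)%N.
  apply/eqP; rewrite -(eqn_pmul2l (cardG_gt0 H)) Lagrange //.
  by rewrite mulnCA rm -cK mulnC Lagrange.
apply: (IH K _ KG _ _ MK).
- by move: oGH; rewrite iK oddM => /andP[].
- rewrite iK in len.
  have : (2 <= r)%N by apply: prime_gt1.
  have := indexg_gt0 G K; nia.
- by rewrite cS' iK card_prod card_ord -rm; ring.
Qed.

End MagicFamilies.

(** * Arrays with both sides an odd prime *)

Lemma sum_ord_odd m : \sum_(i < m.*2.+1) (i : nat)%:Z = m%:Z * m.*2.+1%:Z.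
Proof.
elim: m => [|m IH]; first by rewrite big_ord_recl big_ord0.
by rewrite doubleS 2!big_ord_recr /= IH; lia.
Qed.

Lemma sum_centred m : \sum_(i < m.*2.+1) ((i : nat)%:Z - m%:Z) = 0.
Proof.
by rewrite sumrB sum_ord_odd sumr_const card_ord pmulrn mulrzz; ring.
Qed.

(** Over 2n + m indices these signs add up to m; with m = p this is zero
    modulo p. *)
Definition signs n (j : nat) : int := if (j < n)%N then -1 else 1.

Lemma signsE n j : signs n j = 1 \/ signs n j = -1.
Proof. by rewrite /signs; case: ifP; [right|left]. Qed.

Lemma sum_signs n m : \sum_(j < n.*2 + m) signs n j = m%:Z.
Proof.
rewrite -(big_mkord xpredT (signs n)) (@big_cat_nat _ _ _ n) //=; last by lia.
rewrite (eq_big_nat _ _ (F2 := fun=> -1)); last first.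
  by move=> x /andP[_ xn]; rewrite /signs xn.
rewrite [X in _ + X](eq_big_nat _ _ (F2 := fun=> 1)); last first.
  by move=> x /andP[nx _]; rewrite /signs ltnNge nx.
by rewrite !sumr_const_nat !pmulrn !mulrzz; lia.
Qed.

(** Weights of the rows: they add up to zero, and modulo a prime q > p all of
    them are units. *)
Definition zero_weight p (i : nat) : int := if i == 0%N then 1 - p%:Z else 1.

Lemma sum_zero_weight p : (0 < p)%N -> \sum_(i < p) zero_weight p i = 0.
Proof.
case: p => // p _; rewrite big_ord_recl (eq_bigr (fun=> 1)) //.
by rewrite sumr_const card_ord /zero_weight /= pmulrn mulrzz; lia.
Qed.

Lemma dvdz_signs p s t (i k : nat) : (i < p)%N -> (k < p)%N ->
  s = 1 \/ s = -1 -> t = 1 \/ t = -1 -> (p %| s * i%:Z - t * k%:Z)%Z ->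
  (i == 0%N) = (k == 0%N).
Proof.
have small e (n : nat) : e = 1 \/ e = -1 -> (n < p)%N -> (p %| e * n%:Z)%Z -> n = 0%N.
  move=> ee np d; have d' : (p %| n%:Z)%Z.
    by move: d; case: ee => ->; rewrite ?mul1r // mulN1r rpredN.
  have := dvdz_small d'; lia.
move=> ip kp es et d; apply/eqP/eqP => x0; rewrite x0 mulr0 ?sub0r ?subr0 ?rpredN in d.
  exact: small d.
exact: small d.
Qed.

Lemma dvdz_diff_small p (i k : nat) : (i < p)%N -> (k < p)%N ->
  (p %| i%:Z - k%:Z)%Z -> i = k.
Proof.
by move=> ip kp d; have := dvdz_small d; lia.
Qed.

(** The map (i, j) -> (signs j i mod p, weight i j mod q) is injective: the
    weight depends only on whether i is zero, which is visible on signs j i,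
    so j can be recovered first and then i. *)
Lemma weighted_pair_inj p q n i j k l :
  prime p -> prime q -> (p < q)%N -> (i < p)%N -> (k < p)%N -> (j < q)%N -> (l < q)%N ->
  (p %| signs n j * i%:Z - signs n l * k%:Z)%Z ->
  (q %| zero_weight p i * j%:Z - zero_weight p k * l%:Z)%Z ->
  i = k /\ j = l.
Proof.
move=> prp prq pq ip kp jq lq d1 d2.
have ik0 := dvdz_signs ip kp (signsE n j) (signsE n l) d1.
have jl : j = l.
  apply: (dvdz_diff_small jq lq).
  move: d2; rewrite /zero_weight -ik0; case: ifP => _; last by rewrite !mul1r.
  rewrite -mulrBr Gauss_dvdzr // coprimezE prime_coprime // gtnNdvd //.
    by have := prime_gt1 prp; lia.
  by lia.
split=> //; apply: (dvdz_diff_small ip kp); move: d1.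
by rewrite jl -mulrBr; case: (signsE n l) => ->; rewrite ?mul1r // mulN1r rpredN.
Qed.

Section OddCore.

Variable V : finZmodType.
Implicit Types (H K G : {group V}).

Lemma exists_order_modulo1 p : prime p -> (p %| #|V|)%N ->
  exists u : V, order_modulo 1%G u p.
Proof.
move=> pr pV.
have iV : (p %| #|[set: V]%G : 1|%g)%N by rewrite indexg1 cardsT.
have [u _ [u1 pu]] := exists_order_modulo_prime (sub1G _) pr iV.
by exists u; apply: order_modulo_prime.
Qed.

Lemma order_modulo1_eq0 (u : V) p (n : int) :
  order_modulo 1%G u p -> (u *~ n == 0) = (p %| n)%Z.
Proof. by move=> up; rewrite -up inE zmod1gE. Qed.

(** The maps i - j and i + j are orthogonal Latin squares, 2 being invertible.
    Every row and column of a Latin square contains the whole centred window,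
    so its sum is zero in the integers: no matter whether the subgroup of order
    p^2 is cyclic. *)
Lemma magic_square_prime p : prime p -> odd p -> (p * p %| #|V|)%N ->
  exists2 H : {group V}, #|H| = (p * p)%N & magic H unit 'I_p 'I_p.
Proof.
move=> pr op pV; pose m := p./2.
have pm : p = m.*2.+1 by have := odd_double_half p; rewrite op /m; lia.
have [u u1] := exists_order_modulo1 pr (dvdn_trans (dvdn_mulr _ (dvdnn _)) pV).
have [K [_ uK cK _]] := adjoin_subgroup (prime_gt0 pr) u1.
rewrite cards1 mul1n in cK.
have iV : (p %| #|[set: V]%G : K|%g)%N.
  rewrite -(dvdn_pmul2l (prime_gt0 pr)) -[X in (_ %| X * _)%N]cK.
  by rewrite Lagrange ?subsetT // cardsT.
have [t _ [tK ptK]] := exists_order_modulo_prime (subsetT _) pr iV.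
have tp := order_modulo_prime pr tK ptK.
have [H [KH tH cH _]] := adjoin_subgroup (prime_gt0 pr) tp.
exists H; first by rewrite cH cK.
rewrite pm in tp u1 *.
pose c (z : 'I_(m.*2.+1)) : int := (z : nat)%:Z - m%:Z.
have c_bound y z : `|c y - c z| < m.*2.+1%:Z.
  by have := ltn_ord y; have := ltn_ord z; rewrite /c; lia.
have c_inj : injective c by move=> y z ; rewrite /c => E; apply: val_inj => /=; lia.
exists (fun _ i j => u *~ c (i - j) + t *~ c (i + j)); split.
- move=> [] i j [] k l E.
  have [||+ /c_inj E1] := order_modulo_inj tp _ _ E (c_bound _ _);
    rewrite ?memgMz //.
  rewrite -[LHS]add0r -[RHS]add0r => E0.
  have [||_ /c_inj E2] := order_modulo_inj u1 _ _ E0 (c_bound _ _);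
    rewrite ?memg0 //.
  have ik : i = k.
    (* 2 (i - k) vanishes, in a group of odd order. *)
    have D0 : (i - k) *+ 2 = 0.
      rewrite mulr2n; apply/eqP.
      have -> : (i - k) + (i - k) = (i + j) + (i - j) - ((k + l) + (k - l)).
        by rewrite [i + j + _]addrACA subrr addr0 [k + l + _]addrACA subrr addr0 opprD addrACA.
      by rewrite E1 E2 subrr.
    apply/eqP; rewrite -subr_eq0; apply/eqP.
    have := mulrn_card_group (in_setT (i - k) : i - k \in [set: 'I_(m.*2.+1)]%G).
    have D1 n : (i - k) *+ n.*2 = 0 by rewrite -(mul2n n) mulrnA D0 mul0rn.
    by rewrite cardsT card_ord mulrS D1 addr0.
  by split=> //; move: E1; rewrite ik => /addrI.
- by move=> _ i j; rewrite memgD ?memgMz // (subsetP KH).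
- by rewrite cH cK !card_ord card_unit mul1n pm.
have sumc (f : 'I_(m.*2.+1) -> 'I_(m.*2.+1)) : injective f -> \sum_x c (f x) = 0.
  by move=> finj; rewrite -[RHS](sum_centred m) [RHS](reindex_inj finj).
exists 0, 0; split=> _ i; rewrite big_split /= -!mulrz_sumr !sumc ?mulr0z ?addr0 //.
- exact: addrI.
- by move=> x y /addrI /oppr_inj.
- exact: addIr.
- exact: addIr.
Qed.

(** With t of order p and u of order q, the entry is the sum of weight i j u and
    sign j i t.  The weights cancel in the columns, and the signs add up to a
    multiple of p in the rows. *)
Lemma magic_rect_primes p q : prime p -> odd p -> prime q -> odd q -> (p < q)%N ->
  (p * q %| #|V|)%N ->
  exists2 H : {group V}, #|H| = (p * q)%N & magic H unit 'I_p 'I_q.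
Proof.
move=> prp op prq oq pq pqV.
have [u u1] := exists_order_modulo1 prq (dvdn_trans (dvdn_mull _ (dvdnn _)) pqV).
have [t t1] := exists_order_modulo1 prp (dvdn_trans (dvdn_mulr _ (dvdnn _)) pqV).
have [K [_ uK cK _]] := adjoin_subgroup (prime_gt0 prq) u1.
rewrite cards1 mul1n in cK.
have ptK : t *+ p = 0 by apply/eqP; rewrite pmulrn (order_modulo1_eq0 _ t1) dvdzz.
have tp : order_modulo K t p.
  apply: order_modulo_prime => //; last by rewrite ptK memg0.
  apply/negP => /mulrn_card_group; rewrite cK pmulrn => /eqP.
  rewrite (order_modulo1_eq0 _ t1) => pq'; have : (p %| q)%N := pq'.
  by rewrite dvdn_prime2 // => /eqP Epq; rewrite Epq ltnn in pq.
have [H [KH tH cH _]] := adjoin_subgroup (prime_gt0 prp) tp.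
exists H; first by rewrite cH cK mulnC.
(* The number of negative signs that makes their sum equal to p. *)
pose n := ((q - p)./2)%N.
have qn : q = (p + n.*2)%N.
  have := odd_double_half (q - p); rewrite oddB ?oq ?op /= 1?ltnW // /n; lia.
exists (fun _ (i : 'I_p) (j : 'I_q) =>
  u *~ (zero_weight p i * (j : nat)%:Z) + t *~ (signs n j * (i : nat)%:Z)); split.
- move=> [] i j [] k l E.
  have d1 := order_modulo_eq tp (memgMz _ uK) (memgMz _ uK) E.
  have Et : t *~ (signs n j * (i : nat)%:Z) = t *~ (signs n l * (k : nat)%:Z).
    by apply/eqP; rewrite -subr_eq0 -mulrzBr (order_modulo1_eq0 _ t1).
  move: E; rewrite Et => /addIr /eqP; rewrite -subr_eq0 -mulrzBr.
  rewrite (order_modulo1_eq0 _ u1) => d2.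
  have [eik ejl] := weighted_pair_inj prp prq pq (ltn_ord i) (ltn_ord k)
    (ltn_ord j) (ltn_ord l) d1 d2.
  by split=> //; apply: val_inj.
- by move=> _ i j; rewrite memgD ?memgMz // (subsetP KH).
- by rewrite cH cK !card_ord card_unit mul1n mulnC.
have sum_odd r : odd r -> \sum_(i < r) (i : nat)%:Z = (r./2)%:Z * r%:Z.
  by move=> or; rewrite -[r in LHS](odd_double_half r) or sum_ord_odd; congr (_ * _); rewrite -[in RHS](odd_double_half r) or.
exists 0, 0; split=> _ i; rewrite big_split /= -!mulrz_sumr.
  rewrite -mulr_sumr -mulr_suml sum_odd // mulrA.
  have -> : \sum_(j < q) signs n j = p by rewrite [in LHS]qn addnC sum_signs.
  apply/eqP; rewrite [X in X + _](_ : _ = 0) ?add0r; last first.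
    by apply/eqP; rewrite (order_modulo1_eq0 _ u1) dvdz_mull.
  by rewrite (order_modulo1_eq0 _ t1) dvdz_mulr.
rewrite -mulr_sumr -mulr_suml sum_odd // mulrA.
rewrite sum_zero_weight ?prime_gt0 // mul0r mulr0z add0r; apply/eqP.
by rewrite (order_modulo1_eq0 _ t1) dvdz_mull.
Qed.

End OddCore.

(** * Both sides even *)

Section EvenEven.

Variable V : finZmodType.
Implicit Types (H K G U : {group V}).

Lemma exists_coset_representatives K U : K \subset U ->
  exists Q : finType, #|Q| = #|U : K|%g /\
  exists r : Q -> V, (forall q, r q \in U) /\
    (forall q q', r q - r q' \in K -> q = q').
Proof.
move=> KU; pose Q := {C : {set V} | C \in rcosets K U}.
exists Q; split; first by rewrite card_sig.
exists (fun q => repr (sval q)).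
have repE (q : Q) : repr (sval q) \in U /\ sval q = (K :* repr (sval q))%g.
  case: q => C /= /rcosetsP[x Ux ->]; split.
    by have /rcosetP[k Kk ->] := mem_repr_rcoset K x; rewrite groupM // (subsetP KU).
  by apply/rcoset_eqP; rewrite rcoset_sym; apply: mem_repr_rcoset.
split=> [q|q q' Kqq']; first by case: (repE q).
apply: val_inj => /=; case: (repE q) => _ ->; case: (repE q') => _ ->.
by apply/rcoset_eqP; rewrite mem_rcoset zmodVgE zmodMgE.
Qed.

Lemma order_modulo2 (t : V) : order_modulo 1%G t 2 -> t != 0 /\ t + t = 0.
Proof.
move=> t2; split; first by rewrite -[t]mulr1z (order_modulo1_eq0 _ t2).
by apply/eqP; rewrite -mulr2n pmulrn (order_modulo1_eq0 _ t2).
Qed.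

(** The two entries of a block on its diagonal lie in U and the two others
    outside it, so the blocks are disjoint; both rows of a block have the sum
    g - t = g + t because 2t = 0. *)
Lemma magic_2x2 : (4 %| #|V|)%N -> exists S : finType, magic [set: V] S bool bool.
Proof.
move=> V4; have cV : #|[set: V]%G : 1|%g = #|V| by rewrite indexg1 cardsT.
have [||U [_ _ cU]] := @exists_intermediate_group V 1%G [set: V]%G (#|V| %/ 2).
- exact: sub1G.
- by rewrite cV; apply/dvdnP; exists 2%N; rewrite mulnC divnK // (dvdn_trans _ V4).
rewrite cards1 mul1n in cU.
have iU2 : (2 %| #|U : 1|%g)%N.
  by rewrite indexg1 cU; move: V4; lia.
have [t Ut [t1 tt]] := exists_order_modulo_prime (sub1G U) (isT : prime 2) iU2.
have t2 : order_modulo 1%G t 2 by apply: order_modulo_prime.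
have [K [_ tK cK memK]] := adjoin_subgroup (isT : 0 < 2)%N t2; rewrite cards1 mul1n in cK.
have KU : K \subset U.
  apply/subsetP => x /memK[h + [n ->]].
  by rewrite inE => /eqP ->; rewrite zmod1gE add0r memgMn.
have [g gU] : exists g, g \notin U.
  apply/existsP; rewrite -negb_forall; apply/negP => /forallP UT.
  have : #|U| = #|V| by rewrite -cardsT; congr #|pred_of_set _|; apply/setP => x; rewrite inE UT.
  by rewrite cU; have := cardG_gt0 U; lia.
have [Q [cQ [r [rU rinj]]]] := exists_coset_representatives KU.
exists Q.
(* w enumerates U. *)
pose w q (b : bool) := r q + t *+ b.
have wU q b : w q b \in U by rewrite memgD // memgMn.
have tb (b : bool) : t *+ b \in K by rewrite memgMn.
have winj q b q' b' : w q b = w q' b' -> q = q' /\ b = b'.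
  move=> E; have qq' : q = q'.
    apply: rinj; have -> : r q - r q' = t *+ b' - t *+ b.
      by apply/eqP; rewrite subr_eq addrAC -[t *+ b' + _]addrC -/(w q' b') -E addrK.
    exact: memgB.
  split=> //; move: E; rewrite qq' => /addrI; have [tn0 _] := order_modulo2 t2.
  by case: b; case: b' => // e; case/eqP: tn0; first [exact: e|exact: (esym e)].
have gw q b : (g - w q b \in U) = false.
  by apply: contraNF gU => H; rewrite -(subrK (w q b) g) memgD.
exists (fun q b1 b2 => if b1 == b2 then w q b2 else g - w q b2); split.
- move=> q b1 b2 q' b1' b2'.
  case: eqP => [->|b12]; case: eqP => [->|b12'].
  + by case/winj => -> ->.
  + by move=> E; have := gw q' b2'; rewrite -E wU.
  + by move=> E; have := gw q b2; rewrite E wU.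
  + move=> /addrI /oppr_inj /winj [-> e]; split=> //.
    by move: e b12 b12'; case: b1; case: b2; case: b1'; case: b2'.
- by move=> *; rewrite inE.
- rewrite card_bool cQ cardsT.
  have := Lagrange KU; rewrite cK cU; case/dvdnP: V4 => k ->; move: #|_ : _|%g => z; lia.
have [_ tt0] := order_modulo2 t2.
exists (g + t), g; split=> q b; rewrite big_bool /w /=.
  case: b => /=; rewrite ?mulr0n ?mulr1n ?addr0; first by rewrite addrC addrA subrK.
  rewrite opprD addrA addrAC subrK; congr (_ + _).
  by apply/eqP; rewrite eq_sym -subr_eq0 opprK tt0.
by case: b => /=; [rewrite addrC subrK|rewrite subrK].
Qed.

End EvenEven.

(** * Necessity *)

Section Necessity.

Variable V : finZmodType.

(** The pairs {x, - x} with x distinct from - x cancel; the enumeration rank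
    selects one element of each pair. *)
Lemma sum_all_elements : \sum_(x : V) x = \sum_(x : V | x == - x) x.
Proof.
pose lt (x : V) := (enum_rank x < enum_rank (- x)%R)%N.
rewrite (bigID (fun x => x == - x)) /= -[RHS]addr0; congr (_ + _).
rewrite (bigID lt) /= [X in _ + X](reindex_inj oppr_inj) /=.
rewrite [X in _ + X](eq_bigl (fun x => (x != - x) && lt x)); last first.
  move=> x; rewrite /lt opprK eq_sym -leqNgt leq_eqVlt.
  case: (eqVneq x (- x)) => //= xNx.
  by rewrite (inj_eq val_inj) (inj_eq enum_rank_inj) (negbTE xNx).
by rewrite sumrN subrr.
Qed.

Lemma involutionP (x : V) : (x \in involution_set V) = (x != 0) && (x == - x).
Proof.
rewrite inE -[x == - x]subr_eq0 opprK -mulr2n.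
have eq1 (y : V) : (y == 0) = (y == 1%g) by rewrite zmod1gE.
rewrite !eq1 -zmodXgE -order_dvdn -order_eq1.
have := order_gt0 x; case: #[x]%g => [|[|[|n]]] //= _.
Qed.

(** The sum of all elements would be the unique involution x, and an odd
    multiple of x would be a multiple of |V|. *)
Lemma MRS_necessary a b c (M : 'I_c -> 'M[V]_(a, b)) :
  #|V| = (a * b * c)%N -> odd a || odd b -> is_MRS M -> in_calG V.
Proof.
move=> cV oab [Mbij [w [d [row col]]]].
rewrite /in_calG; case: (boolP (odd #|V|)) => //= eV; rewrite ltnNge; apply/negP => inv1.
have [x xI] : exists x : V, x \in involution_set V.
  have V2 : (2 %| #|V|)%N by rewrite dvdn2.
  have [t /order_modulo2 [t0 tt]] := exists_order_modulo1 (isT : prime 2) V2.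
  by exists t; rewrite involutionP t0 -subr_eq0 opprK tt /=.
have Ix : involution_set V = [set x].
  by apply/eqP; rewrite eq_sym eqEcard sub1set xI cards1.
have sumV : \sum_(y : V) y = x.
  rewrite sum_all_elements (bigD1 0) ?oppr0 //= add0r (bigD1 x) /=; last first.
    by rewrite andbC -involutionP.
  rewrite big1 ?addr0 // => y /andP[yI yx].
  by move: yI; rewrite andbC -involutionP Ix inE (negbTE yx).
pose F (p : 'I_c * ('I_a * 'I_b)) := M p.1 p.2.1 p.2.2.
have bijF : bijective F.
  apply: inj_card_bij => [p p' E|]; last by rewrite cV !card_prod !card_ord; lia.
  by have [p0 [_ uniq_p]] := Mbij (F p); rewrite -(uniq_p p) // -(uniq_p p').
have sumF : \sum_s \sum_i \sum_j M s i j = x.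
  rewrite -sumV [RHS](reindex F) /=; last exact: onW_bij.
  by rewrite -(pair_bigA _ (fun s q => M s q.1 q.2)) /=; apply: eq_bigr => s _; rewrite pair_bigA.
have x_eq0 n : odd n -> x *+ n = 0 -> x = 0.
  have : x \in involution_set V by [].
  rewrite involutionP -[x == - x]subr_eq0 opprK => /andP[_ /eqP xx] on.
  by rewrite -(odd_double_half n) on mulrnDr -mul2n mulrnA mulr2n xx mul0rn addr0.
have Vy (y : V) : y *+ (a * b * c) = 0.
  by rewrite -cV -cardsT; apply: (mulrn_card_group (H := [set: V]%G)); rewrite inE.
move: xI; rewrite involutionP => /andP[/eqP x0 _]; apply: x0.
case/orP: oab => [oa|ob]; [apply: (x_eq0 a oa)|apply: (x_eq0 b ob)]; rewrite -sumF.
  rewrite (eq_bigr (fun=> d *+ b)) => [|s _]; last first.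
    by rewrite exchange_big /= (eq_bigr (fun=> d)) // sumr_const card_ord.
  by rewrite sumr_const card_ord -!mulrnA -[RHS](Vy d); congr (_ *+ _); lia.
rewrite (eq_bigr (fun=> w *+ a)) => [|s _]; last first.
  by rewrite (eq_bigr (fun=> w)) // sumr_const card_ord.
by rewrite sumr_const card_ord -!mulrnA -[RHS](Vy w); congr (_ *+ _); lia.
Qed.

End Necessity.

(** * Klein four-groups in 2-groups of exponent at most 4 *)

Section Klein.

Variable V : finZmodType.
Implicit Types (H K G U S T : {group V}) (e f g h x : V).

Definition klein (e f : V) : bool :=
  [&& e != 0, f != 0, e != f, e + e == 0 & f + f == 0].

Definition has_klein T : Prop := exists e f, [/\ e \in T, f \in T & klein e f].

Lemma klein_group e f : klein e f ->
  exists E K, [/\ order_modulo 1%G e 2, order_modulo E f 2,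
    e \in E & [/\ E \subset K, f \in K, #|K| = 4%N &
    forall x, x \in K -> exists a b : nat, x = e *+ a + f *+ b]].
Proof.
case/and5P => e0 f0 ef /eqP ee /eqP ff.
have e2 : order_modulo 1%G e 2.
  by apply: order_modulo_prime; rewrite ?mulr2n ?ee ?memg0 // inE zmod1gE.
have [E [_ eE cE memE]] := adjoin_subgroup (isT : 0 < 2)%N e2.
have memE' x : x \in E -> x = 0 \/ x = e.
  case/memE => y; rewrite inE zmod1gE => /eqP -> [n ->]; rewrite add0r.
  rewrite -(odd_double_half n) mulrnDr -mul2n mulrnA mulr2n ee mul0rn addr0.
  by case: odd; [right|left].
have f2 : order_modulo E f 2.
  apply: order_modulo_prime; rewrite ?mulr2n ?ff ?memg0 //; apply/negP => /memE'[] E'.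
    by rewrite E' eqxx in f0.
  by rewrite E' eqxx in ef.
have [K [EK fK cK memK]] := adjoin_subgroup (isT : 0 < 2)%N f2.
exists E, K; split=> //; split=> //; first by rewrite cK cE cards1.
move=> x /memK[y /memE[z]]; rewrite inE zmod1gE => /eqP -> [a ->] [b ->].
by exists a, b; rewrite add0r.
Qed.

Lemma has_klein_card_ge4 T : has_klein T -> (4 <= #|T|)%N.
Proof.
move=> [e [f [eT fT /klein_group [E [K [_ _ eE [EK fK cK memK]]]]]]].
rewrite -cK subset_leq_card //; apply/subsetP => x /memK[a [b ->]].
by rewrite memgD ?memgMn.
Qed.

(** T is a subgroup of index 4 above D = 2S.  If D contains a Klein four-group,
    any such T does; the index of D is the number of solutions of 2x = 0 in S,
    hence divisible by 4.  Otherwise D has at most one nonzero element z, since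
    its elements have order at most 2, and D lies in a Klein four-group
    containing z, above which T is chosen. *)
Lemma exists_index4_has_klein S n :
  #|S| = (2 ^ n)%N -> (4 <= n)%N -> (forall x, x \in S -> x *+ 4 = 0) ->
  has_klein S ->
  exists T, [/\ T \subset S, #|S| = (4 * #|T|)%N,
    forall x, x \in S -> x + x \in T & has_klein T].
Proof.
case: n => [|[|[|[|m]]]] // cS _ S4 [e0 [f0 [e0S f0S ef0]]].
have pS : (2.-group S)%g by rewrite /pgroup cS pnatX.
pose D := ('Mho^1(S))%G.
have DE x : (x \in D) = (x \in [set (y ^+ (2 ^ 1))%g | y in S]).
  by rewrite /= (MhoEabelian 1 pS (zmod_abelian _)).
have DS : D \subset S by apply: Mho_sub.
have dblD x : x \in S -> x + x \in D.
  by move=> Sx; rewrite DE -mulr2n; apply/imsetP; exists x.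
have D2 x : x \in D -> x + x = 0.
  rewrite DE => /imsetP[y Sy ->]; rewrite zmodXgE -mulr2n -mulrnA; exact: S4.
have mkT (L : {group V}) : D \subset L -> L \subset S -> has_klein L -> (4 %| #|S : L|%g)%N ->
  exists T, [/\ T \subset S, #|S| = (4 * #|T|)%N,
    forall x, x \in S -> x + x \in T & has_klein T].
  move=> DL LS [e [f [eL fL ef]]] iL.
  have [|T [LT TS cT]] := @exists_intermediate_group V L S (#|S : L|%g %/ 4) LS.
    by apply/dvdnP; exists 4%N; rewrite mulnC divnK.
  exists T; split=> //.
  - rewrite cT -(Lagrange LS) [RHS]mulnCA; congr (_ * _)%N.
    by rewrite mulnC divnK.
  - by move=> x /dblD; apply/subsetP/(subset_trans DL).
  - by exists e, f; split=> //; apply: (subsetP LT).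
have div4 l : (4 <= 2 ^ l)%N -> (4 %| 2 ^ l)%N.
  by case: l => [|[|l]] // _; rewrite !expnS mulnA dvdn_mulr.
case: (boolP [exists e, exists f, [&& e \in D, f \in D & klein e f]]).
  case/existsP => e /existsP[f /and3P[eD fD ef]].
  apply: (mkT D) => //; first by exists e, f.
  have cO : #|S : D|%g = #|('Ohm_1(S))%g|.
    apply/eqP; rewrite -(eqn_pmul2l (cardG_gt0 D)) Lagrange // mulnC.
    by rewrite mul_card_Ohm_Mho_abelian ?zmod_abelian.
  have /p_natP[l Om] := pgroupS (Ohm_sub 1 S) pS.
  rewrite cO Om; apply: div4; rewrite -Om.
  apply: (@has_klein_card_ge4 ('Ohm_1(S))%G); exists e0, f0; split=> //=.
    rewrite (OhmE _ pS) mem_gen // !inE e0S /= expn1 zmodXgE zmod1gE mulr2n.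
    by case/and5P: ef0.
  rewrite (OhmE _ pS) mem_gen // !inE f0S /= expn1 zmodXgE zmod1gE mulr2n.
  by case/and5P: ef0.
move=> nD.
have nDP x y : x \in D -> y \in D -> x != 0 -> y != 0 -> x = y.
  move=> Dx Dy x0 y0; apply/eqP; apply: contraNT nD => xy.
  apply/existsP; exists x; apply/existsP; exists y.
  by rewrite Dx Dy /klein x0 y0 xy !D2 // eqxx.
have [z [zS z0 zz Dz]] : exists z, [/\ z \in S, z != 0, z + z = 0 &
    forall x, x \in D -> x = 0 \/ x = z].
  case: (boolP [exists z, (z \in D) && (z != 0)]).
    case/existsP => z /andP[Dz z0]; exists z; split=> //.
    - exact: (subsetP DS).
    - exact: D2.
    by move=> x Dx; case: (eqVneq x 0) => [->|x0]; [left|right; apply: nDP].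
  rewrite negb_exists => /forallP D0; case/and5P: ef0 => e00 _ _ /eqP ee _.
  exists e0; split=> // x Dx; left; have := D0 x; rewrite Dx negbK /= => /eqP.
  by [].
have [f [fS zf]] : exists f, f \in S /\ klein z f.
  case/and5P: ef0 => e00 f00 ef0 ee ff.
  case: (eqVneq z e0) => [ze|ze].
    by exists f0; split; rewrite // /klein ze e00 f00 ef0 ee ff.
  by exists e0; split; rewrite // /klein z0 e00 ze zz eqxx ee.
have [E [K [_ _ zE [EK fK cK memK]]]] := klein_group zf.
have zK : z \in K by apply: (subsetP EK).
have KS : K \subset S.
  by apply/subsetP => x /memK[a [b ->]]; rewrite memgD ?memgMn.
apply: (mkT K) => //.
- by apply/subsetP => x /Dz [] ->; rewrite ?memg0.
- by exists z, f.
have iK : #|S : K|%g = (2 ^ m.+2)%N.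
  apply/eqP; rewrite -(eqn_pmul2l (cardG_gt0 K)) Lagrange // cS cK.
  by rewrite !expnS !mulnA.
by rewrite iK; apply: div4; rewrite !expnS mulnA leq_pmulr ?expn_gt0.
Qed.

End Klein.

(** * Three permutations with sum zero *)

Section ZeroSumTriples.

Variable V : finZmodType.
Implicit Types (H K G U S T : {group V}) (I : finType).

(** Three enumerations of S with sum zero; the first two amount to a complete
    mapping of S. *)
Definition zero_sum_triple S I (x : 'I_3 -> I -> V) : Prop :=
  [/\ forall k, injective (x k), forall k i, x k i \in S, #|I| = #|S| &
      forall i, \sum_k x k i = 0].

(** The last condition is what balances the middle columns: exchanging the
    second and third enumeration on one half of the rows does not change their
    column sums. *)
Definition split_triple S I (x : 'I_3 -> I -> V) U : Prop :=
  [/\ zero_sum_triple S x, U \subset S, #|S| = (2 * #|U|)%N &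
      \sum_(i | x 0 i \in U) (x 1 i - x 2 i) = 0].

Lemma sum_injective_image (R : zmodType) S I (f : I -> V) (F : V -> R) :
  injective f -> (forall i, f i \in S) -> #|I| = #|S| ->
  \sum_i F (f i) = \sum_(x in S) F x.
Proof.
move=> finj fS cI.
have -> : S = [set f i | i in I] :> {set V}.
  apply/eqP; rewrite eq_sym eqEcard card_imset // -cI leqnn andbT.
  by apply/subsetP => _ /imsetP[i _ ->].
by rewrite big_imset //= => x y _ _ /finj.
Qed.

(** For g, h independent modulo T, the four values 0, g, h, - (g + h) represent
    S / T; rotating the last three as k varies gives three permutations of
    them with sum zero in S itself, so nothing is carried into T. *)
Definition klein_transversal (g h : V) (k : 'I_3) (o : option 'I_3) : V :=
  if o is Some c then [fun d : 'I_3 => - (g + h) with 0 |-> g, 1 |-> h] (c + k)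
  else 0.

Lemma sum_klein_transversal g h o : \sum_k klein_transversal g h k o = 0.
Proof.
case: o => [c|] /=; last by rewrite big1.
transitivity (\sum_d [fun d : 'I_3 => - (g + h) with 0 |-> g, 1 |-> h] d).
  by rewrite [RHS](reindex_inj (addrI c)).
by rewrite !big_ord_recl big_ord0 /= addr0 addrA subrr.
Qed.

(** The triple of T plus the rotated transversal.  For U = T + <g> the balancing
    sum is a sum over T, where it vanishes since the three enumerations of T
    have the same sum, plus |T| times a difference of transversal values, which
    vanishes when 4 divides |T| and S has exponent at most 4. *)
Lemma extend_triple T S I (x : 'I_3 -> I -> V) :
  zero_sum_triple T x -> T \subset S -> #|S| = (4 * #|T|)%N ->
  (forall y, y \in S -> y + y \in T) ->
  exists y : 'I_3 -> I * option 'I_3 -> V, zero_sum_triple S y /\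
    ((4 %| #|T|)%N -> (forall y, y \in S -> y *+ 4 = 0) ->
     exists U, split_triple S y U).
Proof.
move=> [xinj xT cI xsum] TS cS dbl.
have iT : #|S : T|%g = 4%N.
  by apply/eqP; rewrite -(eqn_pmul2l (cardG_gt0 T)) Lagrange // cS mulnC.
have iT2 : (2 %| #|S : T|%g)%N by rewrite iT.
have [g gS [gT ggT]] := exists_order_modulo_prime TS (isT : prime 2) iT2.
have g2 : order_modulo T g 2 by apply: order_modulo_prime.
have [U [TU gU cU memU]] := adjoin_subgroup (isT : 0 < 2)%N g2.
have US : U \subset S.
  by apply/subsetP => y /memU[t tT [n ->]]; rewrite memgD ?memgMn // (subsetP TS).
have [h hS hU] : exists2 h, h \in S & h \notin U.
  apply/subsetPn; apply/negP => /subset_leq_card; rewrite cU cS.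
  by have := cardG_gt0 T; lia.
have hT : h \notin T by apply: contra hU; apply/subsetP.
have ghU : g + h \notin U by rewrite memgDl.
have ghT : g + h \notin T by apply: contra ghU; apply/subsetP.
have wS k o : klein_transversal g h k o \in S.
  case: o => [c|] /=; last exact: memg0.
  by case: eqP => _ //; case: eqP => _ //; rewrite memgN memgD.
(* Modulo T every element is its own opposite. *)
have subT y z : z \in S -> (y - z \in T) = (z + y \in T).
  by move=> zS; rewrite -(memgDl (y - z) (dbl z zS)) addrACA subrr addr0.
have transversal_inj k o o' : klein_transversal g h k o - klein_transversal g h k o' \in T -> o = o'.
  rewrite (subT _ _ (wS k o')); case: o => [c|]; case: o' => [d|] //=; last first.
  - by rewrite addr0; case: ifP => _; [|case: ifP => _]; rewrite ?memgN ?(negbTE gT) ?(negbTE hT) ?(negbTE ghT).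
  - by rewrite add0r; case: ifP => _; [|case: ifP => _]; rewrite ?memgN ?(negbTE gT) ?(negbTE hT) ?(negbTE ghT).
  move=> E; congr Some; apply: (addIr k); move: E.
  have three (z : 'I_3) : [\/ z = 0, z = 1 | z = 2].
    by case: z => [[|[|[|//]]] ?]; [constructor 1|constructor 2|constructor 3]; apply: val_inj.
  have gg : (g + (g + h) \in T) = (h \in T) by rewrite addrA memgDl ?dbl.
  have hh : (h + (g + h) \in T) = (g \in T) by rewrite addrCA addrC memgDl ?dbl.
  have gNgh : (g - (g + h) \in T) = (h \in T) by rewrite opprD addrA subrr add0r memgN.
  have hNgh : (h - (g + h) \in T) = (g \in T) by rewrite addrC opprD subrK memgN.
  case: (three (c + k)) => ->; case: (three (d + k)) => -> //=;
    rewrite ?[_ - _ + _]addrC ?[h + g]addrC ?[- _ + _]addrC ?gNgh ?hNgh;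
    by rewrite ?(negbTE gT) ?(negbTE hT) ?(negbTE ghT).
have x_sum k : \sum_i x k i = \sum_(t in T) t.
  exact: (sum_injective_image id (xinj k) (xT k) cI).
exists (fun k p => x k p.1 + klein_transversal g h k p.2).
have zy : zero_sum_triple S (fun k (p : I * option 'I_3) => x k p.1 + klein_transversal g h k p.2).
  split=> [k [i o] [j o'] /= E|k [i o]||[i o]] /=.
  - have oo' : o = o'.
      apply: (transversal_inj k); have -> : klein_transversal g h k o - klein_transversal g h k o' = x k j - x k i.
        by apply/eqP; rewrite subr_eq addrAC -E addrAC subrr add0r.
      by rewrite memgB.
    by move: E; rewrite oo' => /addIr /xinj ->.
  - by rewrite memgD // (subsetP TS).
  - by rewrite card_prod card_option card_ord cI cS mulnC.
  - by rewrite big_split /= xsum sum_klein_transversal addr0.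
split=> // T4 S4; exists U; split=> //; first by rewrite cS cU [(#|T| * 2)%N]mulnC mulnA.
have memy i o : (x 0 i + klein_transversal g h 0 o \in U) = (o == None) || (o == Some 0).
  rewrite (memgDl _ (subsetP TU _ (xT 0 i))); case: o => [c|]; last exact: memg0.
  rewrite /klein_transversal addr0 /= (inj_eq (@Some_inj _)); case: eqP => [_|_] //=.
  by case: ifP => _; rewrite ?memgN; apply: negbTE.
rewrite (eq_bigl (fun p : I * option 'I_3 => predT p.1 && ((p.2 == None) || (p.2 == Some 0))));
  last by move=> [i o]; rewrite /= memy.
rewrite -(pair_big predT (fun o => (o == None) || (o == Some 0))
  (fun i o => x 1 i + klein_transversal g h 1 o - (x 2 i + klein_transversal g h 2 o))) exchange_big /=.
apply: big1 => o _.
under eq_bigr => i _ do rewrite opprD addrACA.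
rewrite big_split /= sumrB !x_sum subrr add0r sumr_const.
have /dvdnP[m ->] : (4 %| #|I|)%N by rewrite cI.
rewrite mulnC mulrnA S4 ?mul0rn //; exact: memgB.
Qed.

Lemma trivial_triple : zero_sum_triple 1%G (fun (_ : 'I_3) (_ : unit) => 0).
Proof.
split=> [k [] []||| _] //; first by move=> *; exact: memg0.
  by rewrite card_unit cards1.
by rewrite big1.
Qed.

End ZeroSumTriples.

(** The three enumerations of S = <e, f, g> of order 8, in coordinates, where
    <e, f> is a Klein four-group and 2g is either 0 or e.  Rows of the balanced
    half are the first four.  In each column the entries with coefficient -1
    of g come in pairs that differ by e, so that the table is valid in both cases. *)
Definition table8x3 : seq (seq (int * int * int)) :=
  [:: [:: (1, 0, 0); (0, 1, 0); (1, 1, 0); (0, 0, 0);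
          (0, 0, 1); (1, 1, 1); (1, 0, 1); (0, 1, 1)];
      [:: (0, 1, 0); (0, 0, 0); (1, 0, -1); (1, 1, -1);
          (1, 0, 0); (1, 1, 0); (0, 0, -1); (0, 1, -1)];
      [:: (1, 1, 0); (0, 1, 0); (0, 1, 1); (1, 1, 1);
          (1, 0, -1); (0, 0, -1); (1, 0, 0); (0, 0, 0)]].

Definition entry8 (k i : nat) : int * int * int := nth 0 (nth [::] table8x3 k) i.

(** p and q denote the same element of <e, f, g> when 2g = c e. *)
Definition same8 (c : bool) (p q : int * int * int) : bool :=
  [&& (2 %| p.2 - q.2)%Z, (2 %| p.1.2 - q.1.2)%Z &
      (2 %| p.1.1 + c%:Z * ((p.2 - q.2) %/ 2)%Z - q.1.1)%Z].

Lemma same8_inj (c : bool) (k i j : nat) :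
  (k < 3)%N -> (i < 8)%N -> (j < 8)%N -> same8 c (entry8 k i) (entry8 k j) -> i = j.
Proof.
have: all (fun c : bool => all (fun k => all (fun i => all (fun j =>
  same8 c (entry8 k i) (entry8 k j) ==> (i == j)) (iota 0 8)) (iota 0 8)) (iota 0 3))
  [:: true; false] by vm_compute.
move=> /allP/(_ c) H hk hi hj.
have /allP/(_ k) := H (ltac:(by case: (c))); rewrite mem_iota => /(_ hk).
move=> /allP/(_ i); rewrite mem_iota => /(_ hi).
by move=> /allP/(_ j); rewrite mem_iota => /(_ hj) /implyP h /h /eqP.
Qed.

Section SplitTriples.

Variable V : finZmodType.
Implicit Types (H K G U S T : {group V}) (I : finType).

Definition comb3 (e f g : V) (p : int * int * int) : V :=
  e *~ p.1.1 + f *~ p.1.2 + g *~ p.2.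

Lemma comb3D e f g : {morph comb3 e f g : p q / p + q}.
Proof.
move=> p q; rewrite /comb3 !mulrzDr.
by rewrite (addrACA (e *~ _)) (addrACA (e *~ _ + _)).
Qed.

Lemma comb30 e f g : comb3 e f g 0 = 0.
Proof. by rewrite /comb3 !mulr0z !addr0. Qed.

Lemma comb3N e f g p : comb3 e f g (- p) = - comb3 e f g p.
Proof.
by apply/eqP; rewrite -subr_eq0 opprK -comb3D addNr comb30.
Qed.

(** A basis of the Klein four-group can be chosen with 2g in {0, e}; then the
    properties of the triple are finite verifications on the table. *)
Lemma split_triple8 S : #|S| = 8%N -> (forall x, x \in S -> x *+ 4 = 0) ->
  has_klein S ->
  exists U, exists x : 'I_3 -> 'I_8 -> V, split_triple S x U.
Proof.
move=> cS S4 [e0 [f0 [e0S f0S ef0]]].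
have [E0 [K0 [_ _ e0E [EK0 f0K cK0 memK0]]]] := klein_group ef0.
have e0K : e0 \in K0 by apply: (subsetP EK0).
have K0S : K0 \subset S.
  by apply/subsetP => x /memK0[a [b ->]]; rewrite memgD ?memgMn.
have iK0 : #|S : K0|%g = 2%N.
  by apply/eqP; rewrite -(eqn_pmul2l (cardG_gt0 K0)) Lagrange // cS cK0.
have [||g gS [gK0 ggK0]] := @exists_order_modulo_prime V K0 S 2 K0S; rewrite ?iK0 //.
have [e [f [c [eK fK ef gg]]]] : exists e f (c : bool),
    [/\ e \in K0, f \in K0, klein e f & g *+ 2 = e *+ c].
  case: (eqVneq (g *+ 2) 0) => [->|g2]; first by exists e0, f0, false.
  have gg0 : g *+ 2 + g *+ 2 = 0 by rewrite -mulr2n -mulrnA S4.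
  case/and5P: ef0 => e00 f00 ef0 ee ff.
  case: (eqVneq e0 (g *+ 2)) => [eg|eg].
    by exists e0, f0, true; split; rewrite ?eg // /klein -eg e00 f00 ef0 ee ff.
  exists (g *+ 2), e0, true; split=> //.
  by rewrite /klein g2 e00 eq_sym eg ee gg0 eqxx.
have [E [K [e2 f2 eE [EK fK' cK memK]]]] := klein_group ef.
have KK0 : K \subset K0.
  by apply/subsetP => x /memK[a [b ->]]; rewrite memgD ?memgMn.
have eK' : e \in K by apply: (subsetP EK).
have g2 : order_modulo K g 2.
  apply: order_modulo_prime => //; first by apply: contra gK0; apply/subsetP.
  by rewrite gg memgMn.
have mod2 (h : V) (m n : int) : h + h = 0 -> (2 %| m - n)%Z -> h *~ m = h *~ n.
  move=> hh /dvdzP[q mn]; have -> : m = n + q * 2 by rewrite -mn addrCA subrr addr0.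
  by rewrite mulrzDr mulrC mulrzA -pmulrn mulr2n hh mul0rz addr0.
have [ee ff] : e + e = 0 /\ f + f = 0 by case/and5P: ef => _ _ _ /eqP-> /eqP->.
pose phi := comb3 e f g.
have phi_inj p q : phi p = phi q -> same8 c p q.
  move=> E0'; rewrite /same8.
  have c2 : (2 %| p.2 - q.2)%Z.
    by apply: (order_modulo_eq g2 _ _ E0'); rewrite memgD ?memgMz.
  rewrite c2 /=; set m := (_ %/ 2)%Z.
  (* As p.2 - q.2 is even, the difference of the multiples of g is one of e. *)
  have gp : g *~ p.2 = e *~ (c%:Z * m) + g *~ q.2.
    have -> : p.2 = 2 * m + q.2 by rewrite mulrC divzK // subrK.
    by rewrite mulrzDr mulrzA -pmulrn gg pmulrn -mulrzA.
  move: E0'; rewrite /phi /comb3 gp addrA => /addIr; rewrite addrAC -mulrzDr => E1.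
  have b2 := order_modulo_eq f2 (memgMz _ eE) (memgMz _ eE) E1.
  rewrite b2 /=; move: E1; rewrite (mod2 f _ _ ff b2) => /addIr E1.
  by apply: (order_modulo_eq e2 (memg0 _) (memg0 _)); rewrite !add0r.
(* The relations 2e = 2f = 4g = 0. *)
have phi0 p : (2 %| p.1.1)%Z && (2 %| p.1.2)%Z && (4 %| p.2)%Z -> phi p = 0.
  case/andP => /andP[a2 b2] /dvdzP[m c4]; rewrite /phi /comb3.
  rewrite (mod2 e _ 0 ee) ?subr0 // (mod2 f _ 0 ff) ?subr0 // !mulr0z !add0r c4.
  by rewrite mulrC mulrzA -pmulrn S4 // mul0rz.
have phi_sum (I : finType) (P : pred I) F : \sum_(i | P i) phi (F i) = phi (\sum_(i | P i) F i).
  by rewrite /phi (big_morph _ (comb3D e f g) (comb30 e f g)).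
have phiS p : phi p \in S by rewrite /phi /comb3 !memgD // memgMz // (subsetP K0S).
exists K, (fun k i => phi (entry8 k i)); split.
- split=> [k i j /phi_inj E1|||i]; last first.
  + rewrite phi_sum; apply: phi0; rewrite !big_ord_recl big_ord0.
    by case: i; do 8 (case; first by move=> ?; vm_compute).
  + by rewrite card_ord cS.
  + by move=> *; apply: phiS.
  by apply: val_inj; apply: same8_inj E1.
- exact: subset_trans K0S.
- by rewrite cS cK.
have memK8 (i : 'I_8) : (phi (entry8 0 i) \in K) = (i < 4)%N.
  rewrite /phi /comb3 (memgDl _ (memgD (memgMz _ eK') (memgMz _ fK'))) g2.
  by case: i; do 8 (case; first by move=> ?; vm_compute).
under eq_bigl => i do rewrite memK8.
under eq_bigr => i _ do rewrite -comb3N -comb3D.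
rewrite phi_sum; apply: phi0.
rewrite -(big_mkord (fun i => i < 4)%N (fun i => entry8 1 i - entry8 2 i)).
by rewrite unlock; vm_compute.
Qed.

(** Induction on n in steps of two, from the trivial group for order 4 and from
    the table for order 8. *)
Lemma exists_zero_sum_triple n S : #|S| = (2 ^ n)%N -> (2 <= n)%N ->
  (forall x, x \in S -> x *+ 4 = 0) -> has_klein S ->
  exists I (x : 'I_3 -> I -> V), zero_sum_triple S x /\
    ((3 <= n)%N -> exists U, split_triple S x U).
Proof.
elim/ltn_ind: n S => n IH S cS n2 S4 ncS.
have [n4|] := leqP 4 n.
  have [T [TS cST dbl ncT]] := exists_index4_has_klein cS n4 S4 ncS.
  have cT : #|T| = (2 ^ (n - 2))%N.
    apply/eqP; rewrite -(eqn_pmul2l (isT : 0 < 4)%N) -cST cS.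
    by rewrite -[X in (2 ^ X)%N == _](subnKC n2) expnD.
  have [|||I [x [xT _]]] := IH (n - 2)%N _ T cT _ _ ncT.
  - by rewrite ltn_subrL (leq_trans _ n4).
  - by rewrite leq_subRL.
  - by move=> x Tx; apply/S4/(subsetP TS).
  have [y [yS splity]] := extend_triple xT TS cST dbl.
  exists (I * option 'I_3)%type, y; split=> // _; apply: splity => //.
  by rewrite cT -(subnKC (_ : 2 <= n - 2)%N) ?leq_subRL // expnD dvdn_mulr.
move=> n4; have [n_2|n_2] := eqVneq n 2%N; last first.
  have n_3 : n = 3%N by case: n n2 n4 n_2 {IH cS} => [|[|[|[|n]]]].
  have [|U [x xU]] := @split_triple8 S _ S4 ncS; first by rewrite cS n_3.
  by exists 'I_8, x; split=> [|_]; [case: xU | exists U].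
rewrite n_2 in cS *.
have dbl x : x \in S -> x + x \in 1%G.
  case: ncS => e [f [eS fS ef]].
  have [E [K [_ _ eE [EK fK cK memK]]]] := klein_group ef.
  have KS : K \subset S.
    by apply/subsetP => y /memK[a [b ->]]; rewrite memgD ?memgMn.
  have -> : S = K.
    by apply/val_inj/eqP; rewrite /= eq_sym eqEcard KS cK cS.
  case/memK => a [b ->]; case/and5P: ef => _ _ _ /eqP ee /eqP ff.
  by rewrite addrACA -!mulrnDl ee ff !mul0rn addr0 memg0.
have c1 : #|S| = (4 * #|(1%G : {group V})|)%N by rewrite cS cards1.
have [y [yS _]] := extend_triple (trivial_triple V) (sub1G S) c1 dbl.
by exists (unit * option 'I_3)%type, y; split.
Qed.

End SplitTriples.

(** * Arrays with sides |S| and an odd number, S a 2-group *)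

Section EvenCore.

Variable V : finZmodType.
Implicit Types (H K G U S T : {group V}) (I J : finType).

Definition sgn_in U (x : V) : int := if x \in U then 1 else -1.

Lemma sgn_inN U x : sgn_in U (- x) = sgn_in U x.
Proof. by rewrite /sgn_in memgN. Qed.

Lemma sum_sgn_in S U : U \subset S -> #|S| = (2 * #|U|)%N ->
  \sum_(x in S) sgn_in U x = 0.
Proof.
move=> US cS; rewrite (bigID (mem U)) /=.
rewrite (eq_big (mem U) (fun=> 1)); first last.
- by move=> x /andP[_ Ux]; rewrite /sgn_in Ux.
- by move=> x /=; rewrite andb_idl //; apply: (subsetP US).
rewrite [X in _ + X](eq_big (mem (S :\: U)) (fun=> -1)); first last.
- by move=> x /andP[_ Ux]; rewrite /sgn_in (negbTE Ux).
- by move=> x /=; rewrite inE andbC.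
rewrite !sumr_const; have := cardsD S U; rewrite (setIidPr US) cS => ->.
by rewrite mulNrn; apply/eqP; rewrite subr_eq0; apply/eqP; congr (_ *+ _); lia.
Qed.

(** An entry x + y u of the array is handled through its coordinates (x, y). *)
Definition code_val (u : V) (p : V * int) : V := p.1 + u *~ p.2.

Lemma code_valN u p : code_val u (- p) = - code_val u p.
Proof. by rewrite /code_val /= mulrNz opprD. Qed.

(** The middle 2m + 1 columns, whose coefficients of u lie in [-m, m]. *)
Definition zero_sum_core S u (m : nat) I J (C : I -> J -> V * int) : Prop :=
  [/\ forall i j i' j', C i j = C i' j' -> i = i' /\ j = j',
      forall i j, (C i j).1 \in S /\ `|(C i j).2| <= m%:Z,
      #|I| = #|S| /\ #|J| = m.*2.+1,
      forall i, \sum_j code_val u (C i j) = 0 &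
      forall j, \sum_i code_val u (C i j) = 0].

Lemma exists_enumeration S I : #|I| = #|S| ->
  exists2 f : I -> V, injective f & forall i, f i \in S.
Proof.
move=> cI; have [|g bg] := @card_eq_bij I {x | x \in S}; first by rewrite card_sig cI.
by exists (fun i => sval (g i)) => [i j /val_inj /(bij_inj bg)|i] //; apply: (svalP (g i)).
Qed.

(** The columns with coefficients m + k + 1 and - (m + k + 1) of u contain f i and
    - f i, with the sign of the coefficient depending on whether f i is in a
    subgroup U of index 2.  The two columns are opposite, so the rows cancel;
    half of S lies in U, so each column sum is zero; and U being stable under
    opposites, every element occurs. *)
Lemma magic_of_core S u m n I J (C : I -> J -> V * int) :
  order_modulo S u (m + n).*2.+1 -> zero_sum_core S u m C ->
  (2 %| #|S|)%N -> \sum_(x in S) x = 0 ->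
  exists2 H : {group V}, #|H| = (#|S| * (m + n).*2.+1)%N & magic H unit I (J + 'I_n * bool)%type.
Proof.
move=> uq [Cinj Cb [cI cJ] Crow Ccol] S2 S0.
have iS : #|S : 1|%g = #|S| by rewrite indexg1.
have [||U [_ US cU]] := @exists_intermediate_group V 1%G S (#|S| %/ 2); rewrite ?sub1G //.
  by rewrite iS; apply/dvdnP; exists 2%N; rewrite mulnC divnK.
have cS : #|S| = (2 * #|U|)%N by rewrite cU cards1 mul1n mulnC divnK.
have [f finj fS] := exists_enumeration cI.
have f0 : \sum_i f i = 0 by rewrite (sum_injective_image id finj fS cI).
have [H [SH uH cH _]] := adjoin_subgroup (ltn0Sn _) uq.
exists H => //.
pose pr i (k : 'I_n) : V * int := (f i, sgn_in U (f i) * (m + k.+1)%:Z).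
pose D i (j : J + 'I_n * bool) : V * int :=
  match j with
  | inl j => C i j
  | inr (k, b) => if b then - pr i k else pr i k
  end.
have sgn1 x : `|sgn_in U x| = 1 by rewrite /sgn_in; case: ifP.
have Dr i k b : `|(D i (inr (k, b))).2| = (m + k.+1)%:Z.
  by rewrite /= /pr /sgn_in; case: b => /=; case: ifP => _; clear; lia.
have DS i j : (D i j).1 \in S.
  case: j => [j|[k []]] /=; rewrite ?memgN //; by case: (Cb i j).
have Db i j : `|(D i j).2| <= (m + n)%:Z.
  case: j => [j|[k b]]; last by rewrite Dr; have := ltn_ord k; clear; lia.
  by case: (Cb i j) => _ /=; clear; lia.
have Dinj i j i' j' : D i j = D i' j' -> i = i' /\ j = j'.
  case: j => [j|[k b]]; case: j' => [j'|[k' b']] E.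
  - by have [-> ->] := Cinj _ _ _ _ E.
  - have := Dr i' k' b'; rewrite -E /=; case: (Cb i j) => _; clear; lia.
  - have := Dr i k b; rewrite E /=; case: (Cb i' j') => _; clear; lia.
  have kk' : k = k'.
    have := Dr i k b; rewrite E Dr => e; apply: val_inj; move: e; clear => /=; lia.
  move: E; rewrite kk' /=; case: b; case: b'.
  - by move=> /oppr_inj [/finj ->].
  - case=> e1 e2; move: e2; rewrite -e1 sgn_inN /sgn_in; case: ifP; clear; lia.
  - case=> e1 e2; move: e2; rewrite e1 sgn_inN /sgn_in; case: ifP; clear; lia.
  - by case=> /finj ->.
exists (fun _ i j => code_val u (D i j)); split.
- move=> [] i j [] i' j' E.
  have [|e1 e2] := order_modulo_inj uq (DS i j) (DS i' j') E.
    by have := Db i j; have := Db i' j'; clear; lia.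
  have [] := Dinj i j i' j'; first by rewrite (surjective_pairing (D i j)) e1 e2 -surjective_pairing.
  by move=> -> ->.
- by move=> _ i j; rewrite /code_val memgD ?memgMz // (subsetP SH).
- rewrite cH card_unit mul1n card_sum card_prod card_bool card_ord cI cJ.
  by congr (_ * _)%N; clear; lia.
exists 0, 0; split=> _.
  move=> i; rewrite big_sumType /= Crow add0r.
  transitivity (\sum_k \sum_b code_val u (D i (inr (k, b)))).
    by rewrite pair_bigA; apply: eq_bigr => -[].
  by apply: big1 => k _; rewrite big_bool /= code_valN addNr.
case=> [j|[k b]]; first exact: Ccol.
have s0 : \sum_i code_val u (pr i k) = 0.
  rewrite /code_val big_split /= f0 add0r -mulrz_sumr -mulr_suml.
  by rewrite (sum_injective_image _ finj fS cI) sum_sgn_in // mul0r mulr0z.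
case: b; last exact: s0.
by rewrite /= (eq_bigr _ (fun i _ => code_valN u (pr i k))) sumrN s0 oppr0.
Qed.

(** The common column sum s satisfies 3s = 0, by summing all rows, and 4s = 0. *)
Lemma sum_zero_sum_triple S I (x : 'I_3 -> I -> V) :
  zero_sum_triple S x -> (forall y, y \in S -> y *+ 4 = 0) -> forall k, \sum_i x k i = 0.
Proof.
move=> [xinj xS cI xsum] S4 k.
have xs j : \sum_i x j i = \sum_(y in S) y.
  exact: (sum_injective_image id (xinj j) (xS j) cI).
have s3 : (\sum_(y in S) y) *+ 3 = 0.
  transitivity (\sum_i \sum_k x k i); last by apply: big1.
  by rewrite exchange_big /= (eq_bigr _ (fun j _ => xs j)) sumr_const card_ord.
have : (\sum_(y in S) y) *+ 4 = 0 by apply: S4; apply: memg_sum.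
by rewrite xs mulrS s3 addr0.
Qed.

(** In the columns 1 and 2 the coefficient of u is 1 on the second enumeration and
    -1 on the third; on the rows outside the balanced half the two entries are
    exchanged, which makes the coefficients cancel in each column. *)
Lemma core_of_split_triple S u I (x : 'I_3 -> I -> V) U :
  split_triple S x U -> (forall y, y \in S -> y *+ 4 = 0) ->
  exists C : I -> 'I_3 -> V * int, zero_sum_core S u 1 C.
Proof.
move=> [zx US cS split_sum] S4; have x0 := sum_zero_sum_triple zx S4.
case: zx => [xinj xS cI xsum].
have eps0 : \sum_i sgn_in U (x 0 i) = 0.
  by rewrite (sum_injective_image _ (xinj 0) (xS 0) cI) sum_sgn_in.
pose P i : V * int := (x 1 i, 1).
pose N i : V * int := (x 2 i, -1).
pose C i (j : 'I_3) : V * int :=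
  match nat_of_ord j with
  | 0 => (x 0 i, 0)
  | 1 => if x 0 i \in U then P i else N i
  | _ => if x 0 i \in U then N i else P i
  end.
have I3 (j : 'I_3) : [\/ j = 0, j = 1 | j = 2].
  by case: j => [[|[|[|//]]] ?]; [constructor 1|constructor 2|constructor 3]; apply: val_inj.
exists C; split.
- move=> i j i' j'.
  case: (I3 j) => ->; case: (I3 j') => ->; rewrite /C /=;
   (case: (boolP (x 0 i \in U)) => Ui); (case: (boolP (x 0 i' \in U)) => Ui');
   case=> E; try (by []); have ei := xinj _ _ _ E; subst i'; try (by []);
   by move: Ui Ui'; case: (x 0 i \in U).
- move=> i j; case: (I3 j) => ->; rewrite /C /=; first by [].
    by case: ifP => _ /=; split; rewrite ?xS.
  by case: ifP => _ /=; split; rewrite ?xS.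
- by rewrite card_ord.
- move=> i; have := xsum i; rewrite !big_ord_recl !big_ord0 !addr0 /C /code_val /=.
  rewrite (_ : lift ord0 ord0 = 1 :> 'I_3); last exact: val_inj.
  rewrite (_ : lift ord0 (lift ord0 ord0) = 2 :> 'I_3); last exact: val_inj.
  case: ifP => _ /=; rewrite !mulr0z addr0 => <-.
    by rewrite addrACA mulrNz subrr addr0.
  by rewrite [X in _ + X]addrC addrACA mulrNz subrr addr0.
(* The exchange of the two enumerations on one half preserves the sums. *)
have split1 : \sum_(i | x 0 i \in U) x 1 i = \sum_(i | x 0 i \in U) x 2 i.
  by apply/eqP; rewrite -subr_eq0 -sumrB split_sum.
move=> j; rewrite /code_val big_split /= -mulrz_sumr.
have -> : \sum_i (C i j).2 = 0.
  case: (I3 j) => ->; rewrite /C /=; first by rewrite big1.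
    by rewrite -[RHS]eps0; apply: eq_bigr => i _; rewrite /sgn_in; case: ifP.
  by rewrite -[RHS]oppr0 -[in RHS]eps0 -sumrN; apply: eq_bigr => i _; rewrite /sgn_in; case: ifP.
rewrite mulr0z addr0.
case: (I3 j) => ->; rewrite /C /=; first exact: x0.
  rewrite -[RHS](x0 2) [RHS](bigID (fun i => x 0 i \in U)) /= -split1.
  rewrite (bigID (fun i => x 0 i \in U)) /=; congr (_ + _); apply: eq_bigr => i.
    by move=> ->.
  by move=> /negbTE ->.
rewrite -[RHS](x0 1) [RHS](bigID (fun i => x 0 i \in U)) /= split1.
rewrite (bigID (fun i => x 0 i \in U)) /=; congr (_ + _); apply: eq_bigr => i.
  by move=> ->.
by move=> /negbTE ->.
Qed.

End EvenCore.

(** * The case of a Sylow 2-subgroup of order 4 *)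

Definition table_entry (t : seq (seq (int * int * int))) (i j : nat) : int * int * int :=
  nth 0 (nth [::] t i) j.

(** Rows of coordinates on e, f, u.  Here the coefficients of u cancel modulo 3
    only. *)
Definition table4x3 : seq (seq (int * int * int)) :=
  [:: [:: (0, 0, -1); (1, 0, 0); (1, 0, 1)];
      [:: (0, 1, -1); (0, 1, 1); (0, 0, 0)];
      [:: (1, 0, -1); (1, 1, 1); (0, 1, 0)];
      [:: (1, 1, 0); (0, 0, 1); (1, 1, -1)]].

(** Here the coefficients of u cancel in the integers. *)
Definition table4x5 : seq (seq (int * int * int)) :=
  [:: [:: (1, 0, 1); (1, 0, 2); (1, 1, -2); (1, 0, -1); (0, 1, 0)];
      [:: (1, 1, 2); (0, 1, -2); (0, 0, 2); (1, 0, 0); (0, 0, -2)];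
      [:: (1, 1, -1); (0, 0, 0); (1, 1, 1); (0, 1, -1); (0, 1, 1)];
      [:: (1, 0, -2); (1, 1, 0); (0, 0, -1); (0, 1, 2); (0, 0, 1)]].

(** p and q denote the same element x and the same integer coefficient of u. *)
Definition same4 (p q : int * int * int) : bool :=
  [&& p.2 == q.2, (2 %| p.1.2 - q.1.2)%Z & (2 %| p.1.1 - q.1.1)%Z].

(** With w = 0 the last coordinate has to be zero. *)
Definition zero4 (w : nat) (p : int * int * int) : bool :=
  [&& (2 %| p.1.1)%Z, (2 %| p.1.2)%Z & (w %| p.2)%Z].

(** A decidable form of the conditions that make up zero_sum_core. *)
Definition good_table (w m : nat) (t : seq (seq (int * int * int))) : bool :=
  let n := m.*2.+1 in
  [&& all (fun i => all (fun j =>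
        (`|(table_entry t i j).2| <= m%:Z) &&
        all (fun i' => all (fun j' =>
          same4 (table_entry t i j) (table_entry t i' j') ==> (i == i') && (j == j'))
          (iota 0 n)) (iota 0 4)) (iota 0 n)) (iota 0 4),
      all (fun i => zero4 w (foldr (fun j s => table_entry t i j + s) 0 (iota 0 n))) (iota 0 4) &
      all (fun j => zero4 w (foldr (fun i s => table_entry t i j + s) 0 (iota 0 4))) (iota 0 n)].

Lemma good_table4x3 : good_table 3 1 table4x3.
Proof. by vm_compute. Qed.

Lemma good_table4x5 : good_table 0 2 table4x5.
Proof. by vm_compute. Qed.

Lemma allI_ord n (P : pred nat) : all P (iota 0 n) -> forall i : 'I_n, P i.
Proof. by move=> /allP H i; apply: H; rewrite mem_iota ltn_ord. Qed.

Section KleinCore.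

Variable V : finZmodType.
Implicit Types (H K G U S T : {group V}) (I J : finType).

Lemma core_of_table E K e f u q w m t :
  order_modulo 1%G e 2 -> order_modulo E f 2 -> e \in E -> E \subset K -> f \in K ->
  #|K| = 4%N -> e + e = 0 -> f + f = 0 -> u *+ q = 0 -> (q %| w)%N ->
  good_table w m t ->
  exists C : 'I_4 -> 'I_(m.*2.+1) -> V * int, zero_sum_core K u m C.
Proof.
move=> e2 f2 eE EK fK cK ee ff uq qw /and3P[Ht Hrow Hcol].
have eK : e \in K by apply: (subsetP EK).
have val0 p : zero4 w p -> comb3 e f u p = 0.
  case/and3P => /dvdzP[a ea] /dvdzP[b eb] wp.
  have /dvdzP[c ec] : (q %| p.2)%Z by apply: dvdz_trans wp.
  rewrite /comb3 ea eb ec !(mulrC _ 2) (mulrC c) !mulrzA -!pmulrn uq !mulr2n ee ff.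
  by rewrite !mul0rz !addr0.
pose C (i : 'I_4) (j : 'I_(m.*2.+1)) : V * int :=
  let p := table_entry t i j in (e *~ p.1.1 + f *~ p.1.2, p.2).
have Cval i j : code_val u (C i j) = comb3 e f u (table_entry t i j) by [].
have sum_comb n (F : nat -> int * int * int) :
    \sum_(i < n) comb3 e f u (F i) = comb3 e f u (foldr (fun i s => F i + s) 0 (iota 0 n)).
  rewrite -(big_mkord xpredT (fun i => comb3 e f u (F i))) /index_iota subn0.
  elim: (iota 0 n) => [|i s IH] /=; first by rewrite big_nil comb30.
  by rewrite big_cons IH comb3D.
exists C; split.
- move=> i j i' j' [E1 E2].
  have b2 := order_modulo_eq f2 (memgMz _ eE) (memgMz _ eE) E1.
  have fb : f *~ (table_entry t i j).1.2 = f *~ (table_entry t i' j').1.2.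
    apply/eqP; rewrite -subr_eq0 -mulrzBr; case/dvdzP: b2 => b ->.
    by rewrite mulrC mulrzA -pmulrn mulr2n ff mul0rz.
  have a2 : (2 %| (table_entry t i j).1.1 - (table_entry t i' j').1.1)%Z.
    move: E1; rewrite fb => /addIr E1.
    by apply: (order_modulo_eq e2 (memg0 _) (memg0 _)); rewrite !add0r.
  have /(_ j)/andP[_] := allI_ord (allI_ord Ht i).
  move=> /allI_ord/(_ i')/allI_ord/(_ j').
  rewrite /same4 E2 eqxx b2 a2 /= => /andP[/eqP ei /eqP ej].
  by split; apply: val_inj.
- move=> i j; split; first by rewrite memgD ?memgMz.
  by have /(_ j)/andP[] := allI_ord (allI_ord Ht i).
- by rewrite !card_ord cK.
- move=> i; rewrite (sum_comb _ (fun j => table_entry t i j)).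
  exact/val0/(allI_ord Hrow i).
move=> j; rewrite (sum_comb _ (fun i => table_entry t i j)).
exact/val0/(allI_ord Hcol j).
Qed.

(** If S has order at least 8 it has a balanced triple, giving three middle
    columns.  If S has order 4 the tables are used, the second one for q at
    least 5. *)
Lemma magic_even_prime S n q u :
  #|S| = (2 ^ n)%N -> has_klein S -> (forall x, x \in S -> x *+ 4 = 0) ->
  prime q -> odd q -> order_modulo S u q -> u *+ q = 0 ->
  exists2 H : {group V}, #|H| = (#|S| * q)%N & magic H unit 'I_(2 ^ n) 'I_q.
Proof.
move=> cS ncS S4 prq oq uq uq0.
have n2 : (2 <= n)%N.
  by have := has_klein_card_ge4 ncS; rewrite cS; case: (n) => [|[]].
have q3 : (3 <= q)%N by apply: odd_prime_gt2.
have S2 : (2 %| #|S|)%N by rewrite cS -(subnKC n2) expnD dvdn_mulr.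
have [I [x [zx splitx]]] := exists_zero_sum_triple cS n2 S4 ncS.
have S0 : \sum_(y in S) y = 0.
  case: (zx) => [xinj xS cI _].
  by rewrite -[RHS](sum_zero_sum_triple zx S4 0) (sum_injective_image id (xinj 0) (xS 0) cI).
suff [m [k [I' [J [C [qE coreC]]]]]] :
  exists m k I' J (C : I' -> J -> V * int), q = (m + k).*2.+1 /\ zero_sum_core S u m C.
  have [|H cH MH] := magic_of_core (n := k) _ coreC S2 S0; first by rewrite -qE.
  case: coreC => _ _ [cI cJ] _ _; exists H; first by rewrite qE.
  apply: magic_reindex MH; rewrite ?card_ord ?cI //.
  by rewrite card_sum card_prod card_bool card_ord cJ qE; clear; lia.
have qodd := odd_double_half q; rewrite oq in qodd.
have [n3|n_2] := leqP 3 n.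
  have [U xU] := splitx n3.
  have [C coreC] := core_of_split_triple u xU S4.
  exists 1%N, (q./2 - 1)%N, I, _, C; split=> //.
  by move: qodd q3; clear; lia.
have {n_2} n_2 : n = 2%N by apply/eqP; rewrite eqn_leq n2 -ltnS n_2.
rewrite n_2 in cS; case: ncS => e [f [eS fS ef]].
have [E [K [e2 f2 eE [EK fK cK memK]]]] := klein_group ef.
have KS : K \subset S.
  by apply/subsetP => y /memK[a [b ->]]; rewrite memgD ?memgMn.
have SK : S = K by apply/val_inj/eqP; rewrite /= eq_sym eqEcard KS cK cS.
have [ee ff] : e + e = 0 /\ f + f = 0 by case/and5P: ef => _ _ _ /eqP-> /eqP->.
rewrite SK; have [q_3|q_3] := eqVneq q 3%N.
  have q3' : (q %| 3)%N by rewrite q_3.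
  have [C coreC] := core_of_table e2 f2 eE EK fK cK ee ff uq0 q3' good_table4x3.
  by exists 1%N, 0%N, 'I_4, 'I_3, C.
have [C coreC] := core_of_table e2 f2 eE EK fK cK ee ff uq0 (dvdn0 q) good_table4x5.
exists 2%N, (q./2 - 2)%N, 'I_4, _, C; split=> //.
by move: qodd q3 q_3; clear; lia.
Qed.

End KleinCore.

(** * The theorem *)

Section Existence.

Variable V : finZmodType.
Implicit Types (H K G U S T : {group V}).

Lemma magic_even_even a b c :
  #|V| = (a * b * c)%N -> (0 < a)%N -> (0 < b)%N -> ~~ odd a -> ~~ odd b ->
  magic [set: V] 'I_c 'I_a 'I_b.
Proof.
move=> cV a0 b0; rewrite -!dvdn2 => a2 b2.
have [|S MS] := @magic_2x2 V.
  by rewrite cV dvdn_mulr // (dvdn_mul a2 b2).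
apply: (magic_stack_ord (S := S) (m := 2) (n := 2)) => //.
  by rewrite cardsT cV mulnC.
by apply: magic_reindex MS; rewrite ?card_ord ?card_bool.
Qed.

(** Extension by odd index, then stacking. *)
Lemma magic_of_subgroup H a b c p q :
  #|V| = (a * b * c)%N -> (0 < a)%N -> (0 < b)%N -> (p %| a)%N -> (q %| b)%N ->
  (1 < p)%N -> (1 < q)%N -> odd #|[set: V]%G : H|%g -> magic H unit 'I_p 'I_q ->
  magic [set: V] 'I_c 'I_a 'I_b.
Proof.
move=> cV a0 b0 pa qb p1 q1 oH MH.
have MV := magic_extend (subsetT H) oH p1 q1 MH.
apply: (magic_stack_ord (S := 'I_(#|[set: V]%G : H|%g)) a0 b0 pa qb).
  by rewrite cardsT cV mulnC.
by apply: MV; rewrite card_ord card_unit mul1n.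
Qed.

Lemma magic_odd_odd a b c :
  #|V| = (a * b * c)%N -> (1 < a)%N -> (1 < b)%N -> odd a -> odd b -> odd c ->
  magic [set: V] 'I_c 'I_a 'I_b.
Proof.
move=> cV a1 b1 oa ob oc.
have prp := pdiv_prime a1; have prq := pdiv_prime b1.
have pa := pdiv_dvd a; have qb := pdiv_dvd b.
move: (pdiv a) (pdiv b) prp prq pa qb => p q prp prq pa qb.
have op : odd p by apply: dvdn_odd oa.
have oq : odd q by apply: dvdn_odd ob.
have pqV : (p * q %| #|V|)%N by rewrite cV dvdn_mulr // dvdn_mul.
have [H MH] : exists H : {group V}, magic H unit 'I_p 'I_q.
  have [pq|qp|Epq] := ltngtP p q.
  - by have [H _ MH] := magic_rect_primes prp op prq oq pq pqV; exists H.
  - rewrite mulnC in pqV.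
    have [H _ MH] := magic_rect_primes prq oq prp op qp pqV; exists H.
    exact: magic_transpose.
  - rewrite -Epq in pqV *.
    by have [H _ MH] := magic_square_prime prp op pqV; exists H.
apply: (magic_of_subgroup cV _ _ pa qb _ _ _ MH); rewrite ?prime_gt1 ?(ltnW a1) ?(ltnW b1) //.
apply: dvdn_odd (dvdn_indexg _ _) _.
by rewrite cardsT cV !oddM oa ob oc.
Qed.

Lemma klein_of_involutions : (1 < #|involution_set V|)%N ->
  exists e f, [/\ e \in involution_set V, f \in involution_set V & klein e f].
Proof.
case/card_gt1P => e [f [eI fI ef]]; exists e, f; split=> //.
move: eI fI; rewrite !involutionP -![_ == - _]subr_eq0 !opprK /klein ef.
by move=> /andP[-> ->] /andP[-> ->].
Qed.

Lemma in_calG_card : in_calG V -> odd #|V| || (4 %| #|V|)%N.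
Proof.
case/orP => [->//|/klein_of_involutions[e [f [_ _ /klein_group]]]].
case=> E [K [_ _ _ [_ _ cK _]]].
by have := cardSg (subsetT K); rewrite cK cardsT => ->; rewrite orbT.
Qed.

(** The Sylow 2-subgroup contains all involutions, hence a Klein four-group, and
    its exponent divides 4. *)
Lemma magic_even_odd a b c :
  #|V| = (a * b * c)%N -> (1 < a)%N -> (1 < b)%N -> ~~ odd a -> odd b -> odd c ->
  in_calG V -> exponent [set: V] <> 0%N %[mod 8] ->
  magic [set: V] 'I_c 'I_a 'I_b.
Proof.
move=> cV a1 b1 ea ob oc GV expV.
have a0 := ltnW a1; have b0 := ltnW b1; have c0 := odd_gt0 oc.
have inv2 : (1 < #|involution_set V|)%N.
  by move: GV; rewrite /in_calG cV !oddM (negbTE ea).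
have [S sylS] := Sylow_exists 2 [set: V]%G.
have pS : (2.-group S)%g := pHall_pgroup sylS.
have cS : #|S| = (2 ^ logn 2 a)%N.
  rewrite (card_Hall sylS) cardsT cV -mulnA p_part lognM ?muln_gt0 ?b0 ?c0 //.
  by rewrite [X in (_ + X)%N]lognE dvdn2 oddM ob oc andbF addn0.
have memS (x : V) : (x \in S) = (2.-elt x)%g.
  apply: (mem_normal_Hall sylS); last by rewrite inE.
  by rewrite -sub_abelian_normal ?zmod_abelian // subsetT.
have invS (x : V) : x \in involution_set V -> x \in S.
  by rewrite memS inE /p_elt => /eqP ->.
have ncS : has_klein S.
  by have [e [f [eI fI ef]]] := klein_of_involutions inv2; exists e, f; rewrite !invS.
have S4 x : x \in S -> x *+ 4 = 0.
  rewrite memS => /p_natP[l ol].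
  have l2 : (l <= 2)%N.
    rewrite leqNgt; apply/negP => l3; apply: expV; apply/eqP; rewrite mod0n.
    apply: dvdn_trans (dvdn_exponent (in_setT x)); rewrite ol.
    by rewrite -(subnKC l3) expnD dvdn_mulr.
  apply/eqP; rewrite -zmodXgE -[0]zmod1gE -order_dvdn ol.
  by rewrite (_ : 4 = 2 ^ 2)%N // dvdn_exp2l.
have prq := pdiv_prime b1; have qb := pdiv_dvd b.
move: (pdiv b) prq qb => q prq qb.
have oq : odd q by apply: dvdn_odd ob.
have [|u u1] := @exists_order_modulo1 V q prq.
  by rewrite cV dvdn_mulr // dvdn_mull.
have uq0 : u *+ q = 0 by apply/eqP; rewrite pmulrn (order_modulo1_eq0 _ u1) dvdzz.
have uq : order_modulo S u q.
  apply: order_modulo_prime => //; last by rewrite uq0 memg0.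
  apply/negP => /mulrn_card_group; rewrite cS pmulrn => /eqP.
  rewrite (order_modulo1_eq0 _ u1) => qS; have : (q %| 2 ^ logn 2 a)%N := qS.
  rewrite Euclid_dvdX // dvdn_prime2 // => /andP[/eqP q2 _].
  by rewrite q2 in oq.
have [H cH MH] := magic_even_prime cS ncS S4 prq oq uq uq0.
have iS : odd #|[set: V]%G : S|%g.
  by case/and3P: sylS => _ _; rewrite -odd_2'nat.
have la : (0 < logn 2 a)%N by rewrite logn_gt0 mem_primes /= a0 dvdn2.
apply: (magic_of_subgroup cV a0 b0 (pfactor_dvdnn 2 a) qb _ (prime_gt1 prq) _ MH).
  by rewrite -{1}(expn0 2) ltn_exp2l.
suff iHS : (#|[set: V]%G : H|%g * q)%N = #|[set: V]%G : S|%g.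
  by move: iS; rewrite -iHS oddM => /andP[].
apply/eqP; rewrite -(eqn_pmul2l (cardG_gt0 S)) Lagrange ?subsetT //.
by rewrite mulnCA -cH mulnC Lagrange ?subsetT.
Qed.

End Existence.

Theorem theorem4p7 (k c a b : nat) (Gamma : finZmodType)
    (hk : (1 < k)%N) (hk_odd : odd k) (hc_odd : odd c)
    (ha : (1 < a)%N) (hb : (1 < b)%N)
    (hcard : #|Gamma| = (a * b * c)%N)
    (hexp : exponent [set: Gamma] <> 0%N %[mod 8]) :
  (exists M : 'I_c -> 'M[Gamma]_(a, b), is_MRS M) <->
  (~~ odd a /\ ~~ odd b) \/
  (in_calG Gamma /\ ~ ([:: a; b] =i [:: (2 * k + 1)%N; 2%N])).
Proof.
split=> [[M MM]|].
  case: (boolP (odd a || odd b)) => [oab|]; last by rewrite negb_or => /andP; left.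
  have G := MRS_necessary hcard oab MM; right; split=> // abE.
  (* One of a, b is 2 and the other is 2k + 1. *)
  have cE : (#|Gamma| = 2 * ((2 * k + 1) * c))%N.
    have := abE a; have := abE b; have := abE (2 * k + 1)%N; have := abE 2%N.
    rewrite hcard !inE !eqxx ?orbT /=.
    by move=> /orP[]/eqP <- /orP[]/eqP e; rewrite ?e /=; lia.
  have /orP[] := in_calG_card G; rewrite cE.
    by rewrite oddM.
  rewrite (_ : 4 = 2 * 2)%N // dvdn_pmul2l // dvdn2 oddM hc_odd oddD oddM.
  by [].
case: (boolP (odd a)) => oa; case: (boolP (odd b)) => ob H; apply: magic_is_MRS.
- exact: magic_odd_odd.
- have G : in_calG Gamma by case: H => [[]|[]].
  apply: magic_transpose; apply: magic_even_odd => //.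
  by rewrite hcard [(a * b)%N]mulnC.
- have G : in_calG Gamma by case: H => [[]|[]].
  exact: magic_even_odd.
- by apply: magic_even_even; rewrite // ltnW.
Qed.
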